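(* Let $k$ be a field of characteristic zero and $A=k[x,y]$ a polynomial ring in two variables. Define integers $s(n)$ by $s(1)=2$, $s(2)=3$ and $s(n)=n\prod_{1\le i\le n-2}s(i)$ for $n\ge3$. Let $A[Z_0,Z_1,Z_2,\dots]$ be the polynomial ring in countably many variables over $A$, and $$B=A[Z_0,Z_1,Z_2,\dots]/\big(xZ_{i+1}+y^{s(i+1)-1}Z_i^{s(i+1)}-Z_{i-1}\big)_{i\ge1}.$$ Then: (a) $B$ is a non-noetherian UFD of transcendence degree $4$ over $k$, the surjection of $A[Z_0,Z_1,\dots]$ onto $B$ is injective on $A$, $x,y$ are non-associated prime elements of $B$, and $xB+yB$ is a maximal ideal of $B$; (b) letting $B[T]$ be a polynomial ring in one variable over $B$, the ring $B'=B[T]/(xT-y)$ is an integral domain which does not satisfy the ascending chain condition on principal ideals. *)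

(* Defs.v *)
From HB Require Import structures.
From mathcomp Require Import all_boot all_order all_algebra.
From mathcomp Require Export mpoly.

Set Implicit Arguments.
Unset Strict Implicit.
Unset Printing Implicit Defensive.

Import Order.TTheory GRing.Theory Num.Theory.
Local Open Scope ring_scope.

(* s(n) = n * prod_{1<=i<=n-2} s(i) for n >= 3  (s(0) is unused, = 0).  *)
(* sseq n = [:: s 1; ...; s n].                                         *)
Definition snext (m : nat) (l : seq nat) : nat :=
  if m == 1%N then 2%N else if m == 2%N then 3%N
  else (m * \prod_(i <- take (m - 2) l) i)%N.

Fixpoint sseq (n : nat) : seq nat :=
  if n is n'.+1 then rcons (sseq n') (snext n (sseq n')) else [::].

Definition s (n : nat) : nat := nth 0%N (sseq n) n.-1.

Lemma size_sseq n : size (sseq n) = n.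
Proof. by elim: n => //= n IH; rewrite size_rcons IH. Qed.

Lemma nth_sseq n i : (i < n)%N -> nth 0%N (sseq n) i = s i.+1.
Proof.
elim: n => // n IH; rewrite ltnS leq_eqVlt => /orP[/eqP-> | lt_in] /=.
  by rewrite /s /=.
by rewrite nth_rcons size_sseq lt_in IH.
Qed.

Lemma s1 : s 1 = 2%N. Proof. by []. Qed.
Lemma s2 : s 2 = 3%N. Proof. by []. Qed.
Lemma sS n : (3 <= n)%N -> s n = (n * \prod_(1 <= i < n.-1) s i)%N.
Proof.
case: n => // n Hn; rewrite /s /= nth_rcons size_sseq ltnn eqxx /snext.
case: eqP Hn => [->|_] //; case: eqP => [->|_] // Hn.
congr (_ * _)%N; rewrite subSS subn1.
have Hsz : size (take n.-1 (sseq n)) = n.-1.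
  by rewrite size_take size_sseq; case: n Hn => // n _; rewrite /= leqnn.
rewrite (big_nth 0%N) Hsz big_add1 /=.
apply: eq_big_nat => i /andP[_ Hi]; rewrite nth_take // nth_sseq //.
by apply: (leq_trans Hi); case: n {Hn Hsz Hi}.
Qed.

(* Presentation of B = k[x,y][Z_0,Z_1,...]/(x Z_{i+1}+y^{s(i+1)-1} Z_i^{s(i+1)} - Z_{i-1})_{i>=1}
   by its universal property: B is a commutative k-algebra (structure map
   iota) with elements x, y, Z_i satisfying the relations, such that for
   every commutative k-algebra R and elements a, b, z_i of R satisfying
   the relations there is a unique k-algebra morphism B -> R sending
   x, y, Z_i to a, b, z_i.  This determines B up to unique isomorphism. *)
Definition B_rel (R : comPzRingType) (a b : R) (z : nat -> R) : Prop :=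
  forall i : nat, (0 < i)%N ->
    a * z i.+1 + b ^+ (s i.+1).-1 * z i ^+ (s i.+1) - z i.-1 = 0.

Definition presents_B (k : fieldType) (B : comNzRingType)
    (iota : {rmorphism k -> B}) (x y : B) (Z : nat -> B) : Prop :=
  B_rel x y Z /\
  forall (R : comPzRingType) (f : {rmorphism k -> R}) (a b : R) (z : nat -> R),
    B_rel a b z ->
    exists g : {rmorphism B -> R},
      [/\ (forall c, g (iota c) = f c), g x = a, g y = b, (forall i, g (Z i) = z i) &
       forall h : {rmorphism B -> R},
         (forall c, h (iota c) = f c) -> h x = a -> h y = b ->
         (forall i, h (Z i) = z i) -> h =1 g].

Definition A_to_B (k : fieldType) (B : comNzRingType) (iota : {rmorphism k -> B})
    (x y : B) (p : {mpoly k[2]}) : B :=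
  mmap iota (fun i : 'I_2 => if val i == 0%N then x else y) p.

Section CommAlg.
Variable R : comPzRingType.

Definition dvdr (a b : R) : Prop := exists c : R, b = a * c.
Definition unitr (u : R) : Prop := exists v : R, u * v = 1.
Definition associated (a b : R) : Prop := dvdr a b /\ dvdr b a.

Definition integral_domain : Prop :=
  (1 : R) != 0 /\ forall a b : R, a * b = 0 -> a = 0 \/ b = 0.

Definition irreducible_elt (p : R) : Prop :=
  p != 0 /\ ~ unitr p /\ forall a b : R, p = a * b -> unitr a \/ unitr b.

Definition prime_elt (p : R) : Prop :=
  p != 0 /\ ~ unitr p /\ forall a b : R, dvdr p (a * b) -> dvdr p a \/ dvdr p b.

Definition all_irr (l : seq R) : Prop := forall p, p \in l -> irreducible_elt p.

Definition UFD : Prop :=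
  integral_domain /\
  (forall a : R, a != 0 -> ~ unitr a ->
     exists l : seq R, all_irr l /\ a = \prod_(p <- l) p) /\
  (forall l1 l2 : seq R, all_irr l1 -> all_irr l2 ->
     \prod_(p <- l1) p = \prod_(p <- l2) p ->
     exists l2' : seq R, perm_eq l2 l2' /\ size l1 = size l2' /\
       forall i, (i < size l1)%N -> associated (nth 0 l1 i) (nth 0 l2' i)).

Definition ideal (I : R -> Prop) : Prop :=
  [/\ I 0, (forall a b, I a -> I b -> I (a + b)) & (forall r a, I a -> I (r * a))].

Definition noetherian : Prop :=
  forall I : nat -> R -> Prop, (forall n, ideal (I n)) ->
    (forall n a, I n a -> I n.+1 a) ->
    exists N, forall n, (N <= n)%N -> forall a, I n a -> I N a.

Definition maximal_ideal (I : R -> Prop) : Prop :=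
  [/\ ideal I, ~ I 1 &
      forall J : R -> Prop, ideal J -> (forall a, I a -> J a) ->
        (forall a, J a -> I a) \/ J 1].

Definition ACCP : Prop :=
  forall a : nat -> R, (forall n, dvdr (a n.+1) (a n)) ->
    exists N, forall n, (N <= n)%N -> dvdr (a N) (a n).

End CommAlg.

Definition alg_indep (k : fieldType) (B : comNzRingType) (iota : {rmorphism k -> B})
    (n : nat) (v : 'I_n -> B) : Prop :=
  forall p : {mpoly k[n]}, mmap iota v p = 0 -> p = 0.

Definition trdeg_eq (k : fieldType) (B : comNzRingType) (iota : {rmorphism k -> B})
    (d : nat) : Prop :=
  (exists v : 'I_d -> B, alg_indep iota v) /\
  (forall v : 'I_d.+1 -> B, ~ alg_indep iota v).

(* Main.v *)
Require Import Defs.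
From HB Require Import structures.
From mathcomp Require Import all_boot all_order all_algebra.
From mathcomp Require Import mpoly ring.
From Stdlib Require Import Classical ClassicalEpsilon.
Import GRing.Theory.
Local Open Scope ring_scope.
Set Implicit Arguments.
Unset Strict Implicit.
Unset Printing Implicit Defensive.

(** Since Z_(n-1) is a polynomial in x, y, Z_n and Z_(n+1), the ring B is the
increasing union of the subrings k[x, y, Z_n, Z_(n+1)]. Each of them is a
polynomial ring: sending Z_n and Z_(n+1) to indeterminates extends to B, as Z_i
is solved for downwards by the relations and upwards by dividing by x. Hence B is
a domain in which x and y are prime, and every element of B multiplied by a power
of x falls in P = k[x, y, Z_0, Z_1]. By Nagata's criterion, B is factorial once
no nonzero b is divisible by all the powers of x.

Suppose that b is. We may take b = F(Z_1) with F in k[x, y, Z_0][T], of degree d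
in T. As x^M Z_n is in P, its powers 0, ..., d are linearly dependent modulo F
over k[x, y, Z_0]; this gives a nonzero polynomial G over k[x, y, Z_0], of degree
at most d, such that G(Z_n) is divisible by all the powers of x, and we may take G
not divisible by x. Modulo x, however, Z_0 = y^a Z_n^N with
N = s(2) ... s(n+1) > d, so the monomials Z_0^l Z_n^i with i <= d stay
independent, and x divides G: a contradiction.

In B' = B[y/x] each Z_i is x times a combination of Z_(i+1) and Z_(i+2), so Z_0 is
divisible by all the powers of x, whereas x is not a unit. *)

(** * Factorial rings and Nagata's criterion *)

Section Divisibility.
Variable A : comNzRingType.
Hypothesis dom : integral_domain A.
Implicit Types a b c p q u : A.

Lemma domI a b c : a != 0 -> a * b = a * c -> b = c.
Proof.
move=> a0 /eqP; rewrite -subr_eq0 -mulrBr => /eqP /(dom.2) [/eqP|/eqP].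
  by rewrite (negbTE a0).
by rewrite subr_eq0 => /eqP.
Qed.

Lemma dom_mul_neq0 a b : a != 0 -> b != 0 -> a * b != 0.
Proof. by move=> a0 b0; apply/eqP => /(dom.2) [] /eqP; apply/negP. Qed.

Lemma dom_exp_neq0 a n : a != 0 -> a ^+ n != 0.
Proof.
move=> a0; elim: n => [|n IH]; first by rewrite expr0 dom.1.
by rewrite exprS dom_mul_neq0.
Qed.

Lemma dvdr_refl a : dvdr a a. Proof. by exists 1; rewrite mulr1. Qed.

Lemma dvdr_mull a b c : dvdr a b -> dvdr a (c * b).
Proof. by case=> d ->; exists (c * d); rewrite mulrCA. Qed.

Lemma dvdr_mulr a b c : dvdr a b -> dvdr a (b * c).
Proof. by rewrite mulrC; apply: dvdr_mull. Qed.

Lemma dvdr_trans a b c : dvdr a b -> dvdr b c -> dvdr a c.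
Proof. by case=> d -> [e ->]; exists (d * e); rewrite mulrA. Qed.

Lemma unitr_one : unitr (1 : A). Proof. by exists 1; rewrite mulr1. Qed.

Lemma unitr_mul a b : unitr a -> unitr b -> unitr (a * b).
Proof. by case=> u au [v bv]; exists (u * v); rewrite mulrACA au bv mulr1. Qed.

Lemma unitr_mull a b : unitr (a * b) -> unitr a.
Proof. by case=> u; rewrite -mulrA; exists (b * u). Qed.

Lemma unitr_dvd a b : unitr a -> dvdr a b.
Proof. by case=> v av; exists (v * b); rewrite mulrA av mul1r. Qed.

Lemma unitr_neq0 a : unitr a -> a != 0.
Proof.
case=> v av; apply/eqP => a0; move: (dom.1); rewrite -av a0 mul0r.
by rewrite eqxx.
Qed.

Definition prime_list (l : seq A) : Prop := forall p, p \in l -> prime_elt p.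

(* [A] has prime factorisations; for a domain this is equivalent to [UFD A]. *)
Definition factorial_ring : Prop := forall a, a != 0 ->
  exists u l, [/\ unitr u, prime_list l & a = u * \prod_(p <- l) p].

Lemma prime_dvd_prod p (l : seq A) : prime_elt p ->
  dvdr p (\prod_(q <- l) q) -> exists2 q, q \in l & dvdr p q.
Proof.
move=> [p0 [pu pp]]; elim: l => [|q l IH].
  by rewrite big_nil => -[c pc]; case: pu; exists c.
rewrite big_cons => /pp [pq|/IH [r rl pr]].
  by exists q; rewrite ?mem_head.
by exists r; rewrite ?inE ?rl ?orbT.
Qed.

Lemma prime_dvd_exp p a n : prime_elt p -> dvdr p (a ^+ n) -> dvdr p a.
Proof.
move=> [p0 [pu pp]]; elim: n => [|n IH].
  by rewrite expr0 => -[c pc]; case: pu; exists c.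
by rewrite exprS => /pp [].
Qed.

Lemma prime_irreducible p : prime_elt p -> irreducible_elt p.
Proof.
move=> [p0 [pu pp]]; split=> //; split=> // a b pab.
have /pp [[c ac]|[c bc]] : dvdr p (a * b) by rewrite -pab; apply: dvdr_refl.
  right; exists c; apply: (@domI p) => //.
  by rewrite mulrCA -ac mulrC -pab mulr1.
left; exists c; apply: (@domI p) => //.
by rewrite mulrCA -bc -pab mulr1.
Qed.

(** In a prime factorisation of an irreducible [p], split off one prime [q]: the cofactor [w] must
    be a unit, so [p] and [q] have the same multiples and primality passes from [q] to [p]. *)
Lemma factorial_irreducible_prime : factorial_ring ->
  forall p, irreducible_elt p -> prime_elt p.
Proof.
move=> fa p [p0 [pu pirr]]; have [u [l [uu lp pE]]] := fa _ p0.
case: l lp pE => [|q l] lp; first by rewrite big_nil mulr1 => pE; case: pu; rewrite pE.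
rewrite big_cons => pE.
have qp : prime_elt q by apply: lp; rewrite mem_head.
have [q0 [nuq qpp]] := qp.
have : p = q * (u * \prod_(j <- l) j) by rewrite pE mulrCA.
case/pirr => // -[v]; set w := u * _ => wv.
have pq : p = q * w by rewrite pE mulrCA.
have qE : q = p * v by rewrite pq -mulrA wv mulr1.
split=> //; split=> // a b [c abE].
have /qpp [qa|qb] : dvdr q (a * b) by exists (w * c); rewrite abE {1}pq -mulrA.
  by left; apply: dvdr_trans qa; exists v.
by right; apply: dvdr_trans qb; exists v.
Qed.

Lemma irreducible_mul_unit p u : irreducible_elt p -> unitr u ->
  irreducible_elt (p * u).
Proof.
move=> [p0 [pu pirr]] uu; split; first by apply: dom_mul_neq0 => //; exact: unitr_neq0.
split; first by move/unitr_mull.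
case: uu => v uv a b E.
have : p = a * (b * v) by rewrite mulrA -E -mulrA uv mulr1.
by case/pirr => [|/unitr_mull]; [left|right].
Qed.

Lemma irreducible_dvd_associated p q : irreducible_elt p -> irreducible_elt q ->
  dvdr p q -> exists2 u, unitr u & q = p * u.
Proof.
move=> [_ [np _]] [_ [_ qirr]] [u qE]; case: (qirr _ _ qE) => //.
by exists u.
Qed.

(** The unit [u] makes the induction on [l1] go through: cancelling [p] against an associate
    [q = p * v] of [l2] leaves the unit [u * v]. *)
Lemma irreducible_factorisation_unique u (l1 l2 : seq A) :
  (forall p, irreducible_elt p -> prime_elt p) -> unitr u ->
  all_irr l1 -> all_irr l2 ->
  \prod_(p <- l1) p = u * \prod_(p <- l2) p ->
  exists l2' : seq A, perm_eq l2 l2' /\ size l1 = size l2' /\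
    forall i, (i < size l1)%N -> associated (nth 0 l1 i) (nth 0 l2' i).
Proof.
move=> irrp; elim: l1 l2 u => [|p l1 IH] l2 u uu h1 h2.
  rewrite big_nil => E; exists [::]; split; last by split.
  case: l2 h2 E => // q l2 h2; rewrite big_cons mulrCA => E.
  have [_ [nq _]] : irreducible_elt q by apply: h2; rewrite mem_head.
  by case: nq; exists (u * \prod_(j <- l2) j).
rewrite big_cons => E.
have pirr : irreducible_elt p by apply: h1; rewrite mem_head.
have pp := irrp _ pirr; have [p0 [np pdiv]] := pp.
have : dvdr p (u * \prod_(j <- l2) j) by rewrite -E; exists (\prod_(j <- l1) j).
case/pdiv => [[c uE]|/(prime_dvd_prod pp) [q ql2 pq]].
  by case: np; apply: (@unitr_mull p c); rewrite -uE.
have qirr : irreducible_elt q by apply: h2.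
have [v vu qE] := irreducible_dvd_associated pirr qirr pq.
have E' : \prod_(j <- l1) j = (u * v) * \prod_(j <- rem q l2) j.
  apply: (@domI p) => //; rewrite E (big_rem q) //= qE.
  by rewrite mulrCA [u * v]mulrC !mulrA -!mulrA; congr (_ * (_ * _)); rewrite mulrC.
have [||l' [lperm [lsz lass]]] := IH _ _ (unitr_mul uu vu) _ _ E'.
- by move=> r rl; apply: h1; rewrite inE rl orbT.
- by move=> r /mem_rem; apply: h2.
exists (q :: l'); split.
  by rewrite (perm_trans (perm_to_rem ql2)) // perm_cons.
split; first by rewrite /= lsz.
case=> [_|i /lass //]; rewrite /=; split=> //.
by case: vu => w vw; exists w; rewrite qE -mulrA vw mulr1.
Qed.

Lemma factorial_UFD : factorial_ring -> UFD A.
Proof.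
move=> fa; split=> //; split; last first.
  move=> l1 l2 h1 h2 E; apply: (@irreducible_factorisation_unique 1) => //.
  - exact: factorial_irreducible_prime.
  - exact: unitr_one.
  - by rewrite mul1r.
move=> a a0 na; have [u [l [uu lp aE]]] := fa _ a0.
case: l lp aE => [|p l] lp; first by rewrite big_nil mulr1 => aE; rewrite aE in na.
(* The unit is absorbed into the first factor. *)
rewrite big_cons => ->; exists (p * u :: l); split; last first.
  by rewrite big_cons mulrA [u * p]mulrC.
have irr q : q \in p :: l -> irreducible_elt q by move=> /lp /prime_irreducible.
move=> q; rewrite inE => /orP [/eqP ->|ql].
  by apply: irreducible_mul_unit => //; apply: irr; rewrite mem_head.
by apply: irr; rewrite inE ql orbT.
Qed.

Section Nagata.
Variable Q : A -> Prop.
Hypothesis Qprime : forall q, Q q -> prime_elt q.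

Definition multQ s := exists u l,
  [/\ unitr u, (forall q, q \in l -> Q q) & s = u * \prod_(q <- l) q].

(* Divisibility in the localisation of [A] at [multQ], expressed inside [A]. *)
Definition dvdQ a b := exists2 s, multQ s & dvdr a (s * b).

Definition primeQ p := p != 0 /\
  forall a b, dvdQ p (a * b) -> dvdQ p a \/ dvdQ p b.

Definition coprimeQ a := forall q, Q q -> ~ dvdr q a.

Lemma multQ1 : multQ 1.
Proof. by exists 1, [::]; split=> //; [exact: unitr_one|rewrite big_nil mulr1]. Qed.

Lemma multQ_mul s t : multQ s -> multQ t -> multQ (s * t).
Proof.
move=> [u [l [uu lQ ->]]] [v [m [uv mQ ->]]]; exists (u * v), (l ++ m); split.
- exact: unitr_mul.
- by move=> q; rewrite mem_cat => /orP [/lQ|/mQ].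
- by rewrite big_cat mulrACA.
Qed.

Lemma multQ_neq0 s : multQ s -> s != 0.
Proof.
move=> [u [l [/unitr_neq0 u0 lQ ->]]]; apply: dom_mul_neq0 => //.
elim: l lQ => [|q l IH] lQ; first by rewrite big_nil dom.1.
rewrite big_cons dom_mul_neq0 //.
  by case: (Qprime (lQ q (mem_head _ _))).
by apply: IH => r rl; apply: lQ; rewrite inE rl orbT.
Qed.

(** The primes of [s] are cancelled one at a time: each divides [a * b] but not [a], hence divides
    [b]. *)
Lemma coprimeQ_gauss s a b : multQ s -> coprimeQ a -> dvdr s (a * b) -> dvdr s b.
Proof.
move=> [u [l [uu lQ ->]]] ca; case: (uu) => v uv.
suff H : dvdr (\prod_(q <- l) q) (a * b) -> dvdr (\prod_(q <- l) q) b.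
  move=> d; have /H [c ->] : dvdr (\prod_(q <- l) q) (a * b).
    by apply: dvdr_trans d; exists u; rewrite mulrC.
  by exists (v * c); rewrite mulrACA uv mul1r.
elim: l b lQ => [|q l IH] b lQ; first by rewrite big_nil => _; exists b; rewrite mul1r.
rewrite big_cons => -[c abE].
have Qq : Q q by apply: lQ; rewrite mem_head.
have [q0 [_ qp]] := Qprime Qq.
have /qp [/(ca _ Qq) []|[d bE]] : dvdr q (a * b).
  by exists ((\prod_(j <- l) j) * c); rewrite abE mulrA.
have /IH [|e dE] : dvdr (\prod_(j <- l) j) (a * d).
- by exists c; apply: (@domI q) => //; rewrite [RHS]mulrA -abE bE mulrCA.
- by move=> r rl; apply: lQ; rewrite inE rl orbT.
by exists e; rewrite bE dE mulrA.
Qed.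

Lemma coprimeQ_prod (l : seq A) :
  (forall a, a \in l -> coprimeQ a) -> coprimeQ (\prod_(a <- l) a).
Proof.
move=> lc q Qq /(prime_dvd_prod (Qprime Qq)) [a al]; exact: (lc _ al).
Qed.

(** The two inputs of Nagata's criterion: finitely many divisions by primes of [Q] exhaust them in
    any nonzero element, and the localisation is factorial. *)
Hypothesis Qpart : forall a, a != 0 ->
  exists2 s, multQ s & exists2 a', a = s * a' & coprimeQ a'.
Hypothesis primeQ_factorisation : forall a, a != 0 ->
  exists2 s, multQ s &
  exists2 l, (forall p, p \in l -> primeQ p) & s * a = \prod_(p <- l) p.

Lemma coprime_primeQ s p : multQ s -> primeQ (s * p) -> coprimeQ p ->
  unitr p \/ prime_elt p.
Proof.
move=> Ss [sp0 spp] cp; case: (classic (unitr p)) => [|pu]; first by left.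
right; split.
  by apply: contraNneq sp0 => ->; rewrite mulr0.
split=> // a b [c abE].
(* Divisibility by [p] descends from the localisation to [A]: the denominator [t] is a product of
   primes of [Q] up to a unit, and none of them divides [p]. *)
have dvd e : dvdQ (s * p) e -> dvdr p e.
  case=> t St [d tE].
  have /(coprimeQ_gauss St cp) [f dE] : dvdr t (p * (s * d)).
    by exists e; rewrite tE mulrCA mulrA.
  exists f; apply: (@domI t); first exact: multQ_neq0.
  by rewrite tE mulrAC [s * d]dE [RHS]mulrA mulrC mulrA [p * t]mulrC mulrAC.
case: (spp a b) => [|/dvd|/dvd]; [|by left|by right].
by exists s => //; exists c; rewrite abE mulrA.
Qed.

Lemma coprimeQ_parts (l : seq A) : (forall p, p \in l -> primeQ p) ->
  exists2 s, multQ s & exists u m, [/\ unitr u, prime_list m,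
    forall p, p \in m -> coprimeQ p &
    \prod_(p <- l) p = s * (u * \prod_(p <- m) p)].
Proof.
elim: l => [|p l IH] lp.
  exists 1; first exact: multQ1.
  by exists 1, [::]; split=> //; [exact: unitr_one|rewrite !big_nil !mulr1].
have [|s Ss [u [m [uu mp mc E]]]] := IH; first by move=> q ql; apply: lp; rewrite inE ql orbT.
have pQ : primeQ p by apply: lp; rewrite mem_head.
have [t St [p' pE cp]] := Qpart pQ.1.
rewrite pE in pQ; exists (t * s); first exact: multQ_mul.
case: (coprime_primeQ St pQ cp) => [up|pp].
  exists (p' * u), m; split=> //; first exact: unitr_mul.
  by rewrite big_cons pE E mulrACA !mulrA.
exists u, (p' :: m); split=> //.
- by move=> q; rewrite inE => /orP [/eqP ->|/mp].
- by move=> q; rewrite inE => /orP [/eqP ->|/mc].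
- by rewrite !big_cons pE E mulrACA -!mulrA; congr (_ * (_ * _)); rewrite mulrCA.
Qed.

(** Write [a = s0 * a'] with [a'] coprime to [Q]. Factoring in the localisation gives
    [s * s0 * a' = t * (u * q)], with [q] a product of primes coprime to [Q]. By [coprimeQ_gauss],
    [s * s0] and [t] divide each other, so [a'] is [q] up to a unit. *)
Theorem nagata : factorial_ring.
Proof.
move=> a a0; have [s0 S0 [a' aE ca']] := Qpart a0.
have [s Ss [l lp sE]] := primeQ_factorisation a0.
have [t St [u [m [uu mp mc lE]]]] := coprimeQ_parts lp.
set q := \prod_(p <- m) p in lE.
have cq : coprimeQ (u * q).
  move=> r Qr [d uqE]; apply: (coprimeQ_prod mc Qr).
  by case: uu => v uv; exists (d * v); rewrite mulrA -uqE mulrAC uv mul1r.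
have Sss := multQ_mul Ss S0.
have E : s * s0 * a' = t * (u * q) by rewrite -mulrA -aE sE lE.
have /(coprimeQ_gauss Sss cq) [e tE] : dvdr (s * s0) (u * q * t).
  by exists a'; rewrite E mulrC.
have a'E : a' = e * (u * q).
  apply: (@domI (s * s0)); first exact: multQ_neq0.
  by rewrite E {1}tE !mulrA.
have /(coprimeQ_gauss St ca') [f fE] : dvdr t (a' * (s * s0)).
  by exists (u * q); rewrite mulrC E.
have ue : unitr e.
  exists f; apply: (@domI (s * s0)); first exact: multQ_neq0.
  by rewrite mulrA -tE -fE mulr1.
have [v [n [uv nQ s0E]]] := S0.
exists (v * (e * u)), (n ++ m); split.
- by do !apply: unitr_mul.
- by move=> r; rewrite mem_cat => /orP [/nQ /Qprime|/mp].
- by rewrite big_cat aE a'E s0E /= -/q [e * _]mulrA mulrACA.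
Qed.

End Nagata.
End Divisibility.

(** * Gauss' theorem *)

Lemma idomain_integral (R : idomainType) : integral_domain R.
Proof.
split; first exact: oner_neq0.
by move=> a b /eqP; rewrite mulf_eq0 => /orP [] /eqP; [left|right].
Qed.

Lemma poly_coef0_eq0 (R : nzRingType) (p : {poly R}) :
  p`_0 = 0 -> exists q, p = q * 'X.
Proof.
elim/poly_ind: p => [_|p c _]; first by exists 0; rewrite mul0r.
by rewrite coefD coefMX coefC /= add0r => ->; exists p; rewrite addr0.
Qed.

Lemma prime_polyX (R : idomainType) : prime_elt ('X : {poly R}).
Proof.
split; first by rewrite polyX_eq0.
split.
  case=> v /(congr1 (fun p : {poly R} => p`_0)); rewrite coefXM coef1 /= => /eqP.
  by rewrite eq_sym oner_eq0.
move=> a b [c /(congr1 (fun p : {poly R} => p`_0))]; rewrite coefXM coef0M /= => /eqP.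
rewrite mulf_eq0 => /orP [] /eqP /poly_coef0_eq0 [q ->]; [left|right];
by exists q; rewrite mulrC.
Qed.

Lemma dvdr_polyC_mulX (R : idomainType) (p : R) (f : {poly R}) : p != 0 ->
  dvdr p%:P (f * 'X) -> dvdr p%:P f.
Proof.
move=> p0 [q E].
have /poly_coef0_eq0 [r rE] : q`_0 = 0.
  have /eqP := congr1 (fun p : {poly R} => p`_0) E.
  by rewrite coefMX coefCM /= eq_sym mulf_eq0 (negbTE p0) => /eqP.
exists r; apply: (mulIf (negbT (polyX_eq0 R))).
by rewrite E rE mulrA.
Qed.

Lemma dvdr_polyC (R : comNzRingType) (a b : R) :
  dvdr a%:P b%:P -> dvdr a b.
Proof.
case=> q /(congr1 (fun p : {poly R} => p`_0)).
by rewrite coefCM coefC /= => ->; exists q`_0.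
Qed.

Lemma unitr_polyC (R : comNzRingType) (a : R) : unitr a -> unitr a%:P.
Proof. by case=> b ab; exists b%:P; rewrite -polyCM ab. Qed.

(** Double induction on the two factors. The constant terms show that [p] divides [a] or [b];
    removing the corresponding multiple of [p] leaves a product divisible by ['X], and the induction
    hypothesis applies after cancelling ['X]. *)
Lemma prime_polyC (R : idomainType) (p : R) : prime_elt p -> prime_elt p%:P.
Proof.
move=> [p0 [pu pp]]; split; first by rewrite polyC_eq0.
split.
  case=> v pv; apply: pu; have [|w pw] := @dvdr_polyC _ p 1; first by exists v.
  by exists w.
have const c : dvdr p c -> dvdr p%:P c%:P.
  by case=> d ->; exists d%:P; rewrite polyCM.
have add f g : dvdr p%:P f -> dvdr p%:P g -> dvdr p%:P (f + g).
  by case=> f' -> [g' ->]; exists (f' + g'); rewrite mulrDr.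
have sub f g : dvdr p%:P (f + g) -> dvdr p%:P g -> dvdr p%:P f.
  by case=> f' E [g' gE]; exists (f' - g'); rewrite mulrBr -E gE addrK.
elim/poly_ind => [|f a IHf] g; first by left; exists 0; rewrite mulr0.
elim/poly_ind: g => [|g b IHg]; first by right; exists 0; rewrite mulr0.
move=> H.
have /pp [pa|pb] : dvdr p (a * b).
  case: H => q /(congr1 (fun p : {poly R} => p`_0)).
  rewrite coef0M !coefD !coefMX !coefC coefCM /= !add0r => ->.
  by exists q`_0.
- have : dvdr p%:P (f * (g * 'X + b%:P) * 'X).
    apply: sub (dvdr_mulr (g * 'X + b%:P) (const _ pa)).
    by move: H; rewrite mulrDl mulrAC.
  move/(dvdr_polyC_mulX p0)/IHf => [pf|]; last by right.
  by left; apply: add; [apply: dvdr_mulr|apply: const].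
have : dvdr p%:P ((f * 'X + a%:P) * g * 'X).
  apply: sub (dvdr_mull (f * 'X + a%:P) (const _ pb)).
  by move: H; rewrite mulrDr mulrA.
move/(dvdr_polyC_mulX p0)/IHg => [|pg]; first by left.
by right; apply: add; [apply: dvdr_mulr|apply: const].
Qed.

Lemma factorial_field (K : fieldType) : factorial_ring K.
Proof.
move=> a a0; exists a, [::]; split=> //; first by exists a^-1; rewrite divff.
by rewrite big_nil mulr1.
Qed.

(** Induction on the degree: a polynomial with a divisor of intermediate degree is split. Otherwise
    its gcd with any [a] is trivial or [p] itself up to a unit, so [p] is prime. *)
Lemma factorial_poly_field (K : fieldType) : factorial_ring {poly K}.
Proof.
move=> p; have [n] := ubnP (size p); elim: n p => // n IH p; rewrite ltnS => pn p0.
have [sp|sp] := leqP (size p) 1.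
  exists p, [::]; split=> //; last by rewrite big_nil mulr1.
  have c0 : p`_0 != 0 by move: p0; rewrite (size1_polyC sp) polyC_eq0 coefC.
  by exists (p`_0)^-1%:P; rewrite (size1_polyC sp) coefC -polyCM divff.
case: (classic (exists q : {poly K}, [/\ (1 < size q)%N, (size q < size p)%N & q %| p])).
  case=> q [q1 qp /divpK E].
  have q0 : q != 0 by rewrite -size_poly_gt0 ltnW.
  have r0 : p %/ q != 0 by apply: contraNneq p0 => r0; rewrite -E r0 mul0r.
  have [||u [l [uu lp qE]]] := IH q => //; first exact: leq_trans qp pn.
  have [||v [m [uv mp rE]]] := IH (p %/ q) => //.
    rewrite size_divp //; apply: leq_trans pn.
    by rewrite ltn_subrL (ltnW sp) andbT; case: (size q) q1 => [|[]].
  exists (u * v), (l ++ m); split.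
  - exact: unitr_mul.
  - by move=> r; rewrite mem_cat => /orP [/lp|/mp].
  - by rewrite big_cat mulrACA -qE -rE mulrC.
move=> irr; exists 1, [:: p]; split.
- exact: unitr_one.
- move=> q; rewrite inE => /eqP ->; split=> //; split.
    case=> v /(congr1 (fun q : {poly K} => size q)) E.
    have v0 : v != 0.
      by apply/eqP => v0; move/eqP: E; rewrite v0 mulr0 size_poly0 size_poly1.
    move/eqP: E; rewrite size_mul // size_poly1.
    case: (size p) sp => [|[|m]] //= _; rewrite -size_poly_gt0 in v0.
    by case: (size v) v0 => // m' _; rewrite !addSn addnS.
  move=> a b [c abE].
  have pab : p %| a * b by rewrite abE dvdp_mulr.
  have g0 : gcdp p a != 0 by rewrite gcdp_eq0 (negbTE p0).
  have [/eqP g1|g1] := boolP (size (gcdp p a) == 1%N).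
    right; move: pab; rewrite Gauss_dvdpr; last by rewrite coprimep_def g1.
    by case/dvdpP => d ->; exists d; rewrite mulrC.
  left; have : size (gcdp p a) = size p.
    apply/eqP; rewrite eqn_leq dvdp_leq ?dvdp_gcdl //= leqNgt; apply/negP => lt.
    case: irr; exists (gcdp p a); rewrite lt dvdp_gcdl; split=> //.
    by rewrite ltn_neqAle eq_sym g1 size_poly_gt0.
  move=> E; have : gcdp p a %= p by rewrite -dvdp_size_eqp ?dvdp_gcdl // E.
  move/eqp_dvdl => /(_ a); rewrite dvdp_gcdr => /esym /dvdpP [d ->].
  by exists d; rewrite mulrC.
by rewrite big_seq1 mul1r.
Qed.

Section Fractions.
Variable R : idomainType.
Local Notation tofrac := (@FracField.tofrac R).
Local Notation phi := (map_poly tofrac).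

Lemma fraction_denominator (a : {fraction R}) :
  exists2 d, d != 0 & exists n, tofrac d * a = tofrac n.
Proof.
elim/quotW: a => x; exists (\d_x); first exact: denom_ratioP.
exists (\n_x); unlock FracField.tofrac; rewrite -[LHS]FracField.pi_mul.
apply/eqmodP; rewrite /= FracField.equivfE /FracField.mulf.
rewrite !numden_Ratio ?mulf_neq0 ?oner_neq0 ?denom_ratioP //.
by rewrite mul1r mulr1.
Qed.

Lemma poly_fraction_denominator (p : {poly {fraction R}}) :
  exists2 d, d != 0 & exists f, (tofrac d)%:P * p = phi f.
Proof.
elim/poly_ind: p => [|p c [d d0 [f fE]]].
  by exists 1; rewrite ?oner_neq0 //; exists 0; rewrite mulr0 rmorph0.
have [e e0 [n nE]] := fraction_denominator c.
exists (d * e); first by rewrite mulf_neq0.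
exists (e%:P * f * 'X + (d * n)%:P).
rewrite rmorphD !rmorphM /= map_polyX !map_polyC /= -fE -nE rmorphM /=.
have distr (A : comNzRingType) (a b q x z : A) :
  a * b * (q * x + z) = b * (a * q) * x + a * (b * z).
  by rewrite mulrDr !mulrA [b * a]mulrC.
exact: distr.
Qed.

Lemma map_tofrac_inj : injective phi.
Proof.
apply: map_inj_poly; last exact: tofrac0.
by move=> a b /eqP; rewrite tofrac_eq => /eqP.
Qed.
End Fractions.

Section Gauss.
Variable R : idomainType.
Hypothesis fR : factorial_ring R.
Local Notation tofrac := (@FracField.tofrac R).
Local Notation phi := (map_poly tofrac).
(** Nagata's criterion is applied to the constant primes; inverting them yields the polynomials over
    the fraction field. *)
Local Notation Q := (fun f : {poly R} => exists2 p, prime_elt p & f = p%:P).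

Let domR : integral_domain R := @idomain_integral R.

Lemma const_prime (q : {poly R}) : Q q -> prime_elt q.
Proof. by case=> p pp ->; apply: prime_polyC. Qed.

Lemma multQ_const (c : R) : c != 0 -> multQ Q c%:P.
Proof.
move=> c0; have [u [l [uu lp ->]]] := fR c0.
exists u%:P, (map polyC l); split.
- exact: unitr_polyC.
- by move=> q /mapP [p pl ->]; exists p => //; apply: lp.
- by rewrite polyCM big_map rmorph_prod.
Qed.

(** Dividing out a constant prime removes one prime factor from the leading coefficient, so the
    process stops. *)
Lemma primitive_part (f : {poly R}) : f != 0 ->
  exists2 s, multQ Q s & exists2 f', f = s * f' & coprimeQ Q f'.
Proof.
move=> f0; have := f0; rewrite -lead_coef_eq0 => /fR [u [l [uu lp]]].
have [n] := ubnP (size l); elim: n f f0 u l uu lp => // n IH f f0 u l uu lp.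
rewrite ltnS => sl lE.
case: (classic (coprimeQ Q f)) => [cf|].
  by exists 1; [exact: multQ1|exists f; rewrite ?mul1r].
case/not_all_ex_not => q qP; have [[p pp qE] /NNPP] := imply_to_and _ _ qP.
rewrite qE => -[g fE].
have [p0 [pu pdiv]] := pp.
have g0 : g != 0 by apply: contraNneq f0 => g0; rewrite fE g0 mulr0.
have lE' : lead_coef f = p * lead_coef g by rewrite fE lead_coefM lead_coefC.
have : dvdr p (u * \prod_(r <- l) r) by rewrite -lE lE'; exists (lead_coef g).
case/pdiv => [[c uE]|/(prime_dvd_prod pp) [r rl pr]].
  by case: pu; apply: (@unitr_mull _ p c); rewrite -uE.
have [v vu rE] := irreducible_dvd_associated (prime_irreducible domR pp)
  (prime_irreducible domR (lp _ rl)) pr.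
have [||||s Ss [g' gE cg]] := IH g g0 (u * v) (rem r l).
- exact: unitr_mul.
- by move=> q' /mem_rem /lp.
- by rewrite size_rem //; case: (l) rl sl.
- apply: (mulfI p0); rewrite -lE' lE (big_rem r) //= rE.
  by rewrite !mulrA [u * p]mulrC.
exists (p%:P * s); last by exists g'; rewrite ?fE ?gE ?mulrA.
by apply: multQ_mul => //; apply: multQ_const.
Qed.

(** Divisibility by [L] over the fraction field is [dvdQ] by [g]: denominators are cleared in one
    direction, and elements of [multQ Q] become units in the other. *)
Lemma irreducible_primeQ (L : {poly {fraction R}}) g d : d != 0 ->
  unitr L \/ prime_elt L -> L != 0 -> (tofrac d)%:P * L = phi g -> primeQ Q g.
Proof.
move=> d0 LL L0 gE.
have ud c : c != 0 -> unitr (tofrac c)%:P.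
  move=> c0; apply: unitr_polyC; exists (tofrac c)^-1.
  by rewrite divff // tofrac_eq0.
have domK := @idomain_integral {poly {fraction R}}.
split.
  apply/eqP => g0; move/eqP: gE; rewrite g0 rmorph0 mulf_eq0 polyC_eq0 tofrac_eq0.
  by rewrite (negbTE d0) (negbTE L0).
have lift a : dvdr L (phi a) -> dvdQ Q g a.
  case=> H aE; have [e e0 [h hE]] := poly_fraction_denominator H.
  exists (e * d)%:P; first by apply: multQ_const; rewrite mulf_neq0.
  exists h; apply: (@map_tofrac_inj R).
  rewrite [LHS]rmorphM [RHS]rmorphM /= -gE -hE aE map_polyC /= tofracM polyCM.
  have assoc (A : comNzRingType) (x y z t : A) : x * y * (z * t) = y * z * (x * t).
    by rewrite [x * y]mulrC mulrACA.
  exact: assoc.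
move=> a b [s Ss [c cE]].
case: LL => [uL|[_ [_ pL]]]; first by left; apply: lift; apply: unitr_dvd.
have /pL [] : dvdr L (phi a * phi b); [|by left; apply: lift|by right; apply: lift].
have [w sw] : unitr (phi s).
  case: Ss => u [l [[v uv] lQ ->]]; rewrite rmorphM /=; apply: unitr_mul.
    by exists (phi v); rewrite -rmorphM uv rmorph1.
  elim: l lQ => [|q l IH] lQ; first by rewrite big_nil rmorph1; apply: unitr_one.
  rewrite big_cons rmorphM; apply: unitr_mul.
    have [p [p0 _] ->] := lQ q (mem_head _ _).
    by rewrite /= map_polyC; apply: ud.
  by apply: IH => r rl; apply: lQ; rewrite inE rl orbT.
have E : phi s * (phi a * phi b) = (tofrac d)%:P * L * phi c.
  by rewrite gE -!rmorphM -cE.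
exists ((tofrac d)%:P * phi c * w).
have solve_for (A : comNzRingType) (t v e D M C : A) :
    t * v = 1 -> t * e = D * M * C -> e = M * (D * C * v).
  by move=> tv tE; rewrite mulrA [M * _]mulrCA mulrA -tE mulrAC tv mul1r.
exact: solve_for sw E.
Qed.

Theorem factorial_poly : factorial_ring {poly R}.
Proof.
have domX := @idomain_integral {poly R}.
apply: (nagata domX const_prime primitive_part) => f f0.
have pf0 : phi f != 0.
  by apply: contraNneq f0 => pf0; apply/eqP/(@map_tofrac_inj R); rewrite pf0 rmorph0.
have [U [L [uU pL fE]]] := factorial_poly_field pf0.
(* The unit [U] is treated as one more factor, which [primeQ] allows; denominators are then cleared
   factor by factor. *)
have {}pL : forall P, P \in U :: L -> unitr P \/ prime_elt P.
  by move=> P; rewrite inE => /orP [/eqP ->|/pL]; [left|right].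
have L0 : forall P, P \in U :: L -> P != 0.
  move=> P /pL [|[]//]; apply: unitr_neq0; exact: idomain_integral.
have {}fE : phi f = \prod_(P <- U :: L) P by rewrite big_cons.
suff [d d0 [l lp lE]] : exists2 d, d != 0 & exists2 l, (forall p, p \in l -> primeQ Q p) &
    (tofrac d)%:P * \prod_(P <- U :: L) P = phi (\prod_(p <- l) p).
  exists d%:P; first exact: multQ_const.
  exists l => //; apply: (@map_tofrac_inj R).
  by rewrite -lE -fE rmorphM /= map_polyC.
elim: (U :: L) pL L0 => [|P M IH] pL L0.
  exists 1; rewrite ?oner_neq0 //; exists [::] => //.
  by rewrite !big_nil !rmorph1 mulr1.
have [|| d d0 [l lp lE]] := IH.
- by move=> T TM; apply: pL; rewrite inE TM orbT.
- by move=> T TM; apply: L0; rewrite inE TM orbT.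
have [e e0 [g gE]] := poly_fraction_denominator P.
exists (e * d); first by rewrite mulf_neq0.
exists (g :: l); last by rewrite !big_cons !rmorphM /= mulrACA lE gE.
move=> p; rewrite inE => /orP [/eqP ->|/lp //].
apply: (irreducible_primeQ e0 _ _ gE); first by apply: pL; rewrite mem_head.
by apply: L0; rewrite mem_head.
Qed.
End Gauss.

(** * The polynomial rings k[x, y, Z_n, Z_(n+1)] *)

Section EvalMorphism.
Variables (R S : comNzRingType) (f : {rmorphism R -> S}) (a : S).

Definition ev1 (p : {poly R}) : S := (map_poly f p).[a].

Fact ev1_is_zmod_morphism : zmod_morphism ev1.
Proof. by move=> p q; rewrite /ev1 rmorphB hornerD hornerN. Qed.

Fact ev1_is_monoid_morphism : monoid_morphism ev1.
Proof. by split=> [|p q]; rewrite /ev1 ?rmorph1 ?hornerC // rmorphM hornerM. Qed.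

HB.instance Definition _ := GRing.isZmodMorphism.Build {poly R} S ev1 ev1_is_zmod_morphism.
HB.instance Definition _ := GRing.isMonoidMorphism.Build {poly R} S ev1 ev1_is_monoid_morphism.

Lemma ev1C c : ev1 c%:P = f c. Proof. by rewrite /ev1 map_polyC hornerC. Qed.
Lemma ev1X : ev1 'X = a. Proof. by rewrite /ev1 map_polyX hornerX. Qed.
End EvalMorphism.

Lemma rmorph_poly_ev1 (R S : comNzRingType) (g : {rmorphism {poly R} -> S})
    (f : {rmorphism R -> S}) a :
  (forall c, g c%:P = f c) -> g 'X = a -> g =1 ev1 f a.
Proof.
move=> gC gX; elim/poly_ind => [|p c IH]; first by rewrite !rmorph0.
by rewrite !rmorphD !rmorphM /= IH gX gC ev1C ev1X.
Qed.

(* The intermediate rings are named and the variables locked, because unification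
   would otherwise compare the nested polynomial structures. The variables are,
   from the innermost to the outermost, [y], [u], [x], [t]; below [u] and [t]
   become [Z_n] and [Z_(n+1)]. *)
Definition P1 (k : fieldType) : idomainType := {poly k}.
Definition P2 (k : fieldType) : idomainType := {poly P1 k}.
Definition P3 (k : fieldType) : idomainType := {poly P2 k}.
Definition P4 (k : fieldType) : idomainType := {poly P3 k}.


Definition C1 (k : fieldType) : {rmorphism k -> P1 k} := @polyC k.
Definition C2 (k : fieldType) : {rmorphism P1 k -> P2 k} := @polyC (P1 k).
Definition C3 (k : fieldType) : {rmorphism P2 k -> P3 k} := @polyC (P2 k).
Definition C4 (k : fieldType) : {rmorphism P3 k -> P4 k} := @polyC (P3 k).

Definition vC (k : fieldType) : {rmorphism k -> P4 k} := C4 k \o (C3 k \o (C2 k \o C1 k)).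
HB.lock Definition vY (k : fieldType) : P4 k := C4 k (C3 k (C2 k 'X)).
HB.lock Definition vU (k : fieldType) : P4 k := C4 k (C3 k 'X).
HB.lock Definition vX (k : fieldType) : P4 k := C4 k 'X.
HB.lock Definition vT (k : fieldType) : P4 k := 'X.

Section Eval4.
Variable k : fieldType.
Local Notation vC := (vC k).
Local Notation vY := (vY k).
Local Notation vU := (vU k).
Local Notation vX := (vX k).
Local Notation vT := (vT k).
Local Notation C1 := (C1 k).
Local Notation C2 := (C2 k).
Local Notation C3 := (C3 k).
Local Notation C4 := (C4 k).


Section Ev.
Variables (S : comNzRingType) (f : {rmorphism k -> S}) (y u x t : S).
Definition e1 : {rmorphism P1 k -> S} := ev1 f y.
Definition e2 : {rmorphism P2 k -> S} := ev1 e1 u.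
Definition e3 : {rmorphism P3 k -> S} := ev1 e2 x.
Definition ev4 : {rmorphism P4 k -> S} := ev1 e3 t.

Lemma ev4_C4 c : ev4 (C4 c) = e3 c. Proof. exact: ev1C. Qed.
Lemma e3_C3 c : e3 (C3 c) = e2 c. Proof. exact: ev1C. Qed.
Lemma e2_C2 c : e2 (C2 c) = e1 c. Proof. exact: ev1C. Qed.
Lemma e1_C1 c : e1 (C1 c) = f c. Proof. exact: ev1C. Qed.

Lemma ev4C c : ev4 (vC c) = f c.
Proof. by rewrite /vC /= ev4_C4 e3_C3 e2_C2 e1_C1. Qed.
Lemma ev4Y : ev4 vY = y.
Proof. by rewrite vY.unlock ev4_C4 e3_C3 e2_C2; apply: ev1X. Qed.
Lemma ev4U : ev4 vU = u. Proof. by rewrite vU.unlock ev4_C4 e3_C3; apply: ev1X. Qed.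
Lemma ev4X : ev4 vX = x. Proof. by rewrite vX.unlock ev4_C4; apply: ev1X. Qed.
Lemma ev4T : ev4 vT = t. Proof. by rewrite vT.unlock; apply: ev1X. Qed.
Definition ev4E := (ev4C, ev4Y, ev4U, ev4X, ev4T).
End Ev.

Lemma ev4_unique (S : comNzRingType) (f : {rmorphism k -> S}) y u x t
    (g : {rmorphism P4 k -> S}) :
  (forall c, g (vC c) = f c) -> g vY = y -> g vU = u -> g vX = x -> g vT = t ->
  g =1 ev4 f y u x t.
Proof.
rewrite vY.unlock vU.unlock vX.unlock vT.unlock => gC gY gU gX gT.
apply: rmorph_poly_ev1 gT => c; apply: (@rmorph_poly_ev1 _ _ (g \o C4)) gX c => c.
apply: (@rmorph_poly_ev1 _ _ (g \o (C4 \o C3))) gU c => c.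
exact: (@rmorph_poly_ev1 _ _ (g \o (C4 \o (C3 \o C2)))) gC gY c.
Qed.

Lemma eq_ev4 (S : comNzRingType) (f g : {rmorphism k -> S}) y u x t :
  f =1 g -> ev4 f y u x t =1 ev4 g y u x t.
Proof. by move=> fg; apply: ev4_unique => [c||||]; rewrite ev4E ?fg. Qed.

Lemma ev4_id p : ev4 vC vY vU vX vT p = p.
Proof. by rewrite -[RHS]/(idfun p); symmetry; apply: ev4_unique. Qed.

Lemma rmorph_ev4 (S T : comNzRingType) (f : {rmorphism k -> S})
    (g : {rmorphism S -> T}) y u x t p :
  g (ev4 f y u x t p) = ev4 (g \o f) (g y) (g u) (g x) (g t) p.
Proof.
apply: (@ev4_unique _ _ _ _ _ _ (g \o ev4 f y u x t)) => [c||||] /=.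
- by rewrite ev4C.
- by rewrite ev4Y.
- by rewrite ev4U.
- by rewrite ev4X.
- by rewrite ev4T.
Qed.

End Eval4.

(** * Generation by the x, y, Z_i and solutions of the relations *)

Section Generation.
Variables (k : fieldType) (B : comNzRingType) (iota : {rmorphism k -> B}).
Variables (x y : B) (Z : nat -> B).

Inductive generated : B -> Prop :=
| Gen_const c : generated (iota c)
| Gen_x : generated x
| Gen_y : generated y
| Gen_Z i : generated (Z i)
| Gen_sub a b : generated a -> generated b -> generated (a - b)
| Gen_mul a b : generated a -> generated b -> generated (a * b).

(** Substructures are built on boolean predicates, hence the classical decision. *)
Definition gen_pred : {pred B} :=
  fun b => if excluded_middle_informative (generated b) then true else false.

Lemma gen_predP b : b \in gen_pred <-> generated b.
Proof. by rewrite unfold_in /gen_pred; case: excluded_middle_informative. Qed.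

Fact gen_subring : subring_closed gen_pred.
Proof.
split=> [|a b|a b].
- by apply/gen_predP; have := Gen_const 1; rewrite rmorph1.
- by move=> /gen_predP ga /gen_predP gb; apply/gen_predP/Gen_sub.
- by move=> /gen_predP ga /gen_predP gb; apply/gen_predP/Gen_mul.
Qed.

HB.instance Definition _ := GRing.isSubringClosed.Build B gen_pred gen_subring.

Record gen_type := GenType { gen_val : B; _ : gen_val \in gen_pred }.
HB.instance Definition _ := [isSub for gen_val].
HB.instance Definition _ := [Choice of gen_type by <:].
HB.instance Definition _ := [SubChoice_isSubComNzRing of gen_type by <:].

Definition gen_mk b (gb : generated b) : gen_type := GenType ((gen_predP b).2 gb).

Definition gen_iota c : gen_type := gen_mk (Gen_const c).

Fact gen_iota_zmod : zmod_morphism gen_iota.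
Proof. by move=> a b; apply: val_inj; rewrite rmorphB /= rmorphB. Qed.
Fact gen_iota_monoid : monoid_morphism gen_iota.
Proof. by split=> [|a b]; apply: val_inj; rewrite ?rmorph1 ?rmorphM /= ?rmorph1 ?rmorphM. Qed.
HB.instance Definition _ := GRing.isZmodMorphism.Build k gen_type gen_iota gen_iota_zmod.
HB.instance Definition _ := GRing.isMonoidMorphism.Build k gen_type gen_iota gen_iota_monoid.

(** The universal property maps [B] to its subring of generated elements; followed by the inclusion,
    this is the identity by uniqueness. *)
Lemma presents_generated : presents_B iota x y Z -> forall b, generated b.
Proof.
case=> rel univ b.
have rel' : B_rel (gen_mk Gen_x) (gen_mk Gen_y) (fun i => gen_mk (Gen_Z i)).
  move=> i i0; apply: val_inj.
  by rewrite rmorphB rmorphD !rmorphM !rmorphXn /= rel // rmorph0.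
have [g [gi gx gy gZ _]] := univ _ gen_iota _ _ _ rel'.
have [h [_ _ _ _ hu]] := univ _ iota _ _ _ rel.
have -> : b = val (g b).
  rewrite -[LHS]/(idfun b) (hu idfun) // -(hu (val \o g)) //=.
  - by move=> c; rewrite gi.
  - by rewrite gx.
  - by rewrite gy.
  - by move=> i; rewrite gZ.
exact/gen_predP/valP.
Qed.
End Generation.

Section DownSequence.
Variables (R : comPzRingType) (x y : R).

(** The solution of the relations with terms [u] and [v] at the indices [m] and [m.+1], computed
    downwards; it is meaningful only for [i <= m.+1]. *)
Fixpoint zdn m (u v : R) i : R := if m is m'.+1 then
    if i == m.+1 then v
    else zdn m' (x * v + y ^+ (s m.+1).-1 * u ^+ (s m.+1)) u i
  else if i == 0%N then u else v.

Lemma zdn_top m u v : zdn m u v m.+1 = v.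
Proof. by case: m => [|m] //=; rewrite eqxx. Qed.

Lemma zdn_next m u v : zdn m u v m = u.
Proof. by case: m => [|m] //=; rewrite ltn_eqF // zdn_top. Qed.

Lemma zdn_rel m u v i : (0 < i <= m)%N ->
  x * zdn m u v i.+1 + y ^+ (s i.+1).-1 * zdn m u v i ^+ (s i.+1) - zdn m u v i.-1 = 0.
Proof.
elim: m u v i => [|m IH] u v i; first by case: i.
case/andP => i0; rewrite leq_eqVlt => /orP [/eqP ->|im].
  by rewrite zdn_top zdn_next /= ltn_eqF ?zdn_next ?subrr //.
rewrite /= ?eqSS (ltn_eqF im) [i == m.+2]ltn_eqF ?(ltnW im) //.
  rewrite [i.-1 == _]ltn_eqF ?IH ?i0 //.
  by apply: leq_trans (leq_pred i) _; apply: ltnW.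
exact: ltnW.
Qed.

Lemma zdn_unique z : B_rel x y z -> forall m i, (i <= m.+1)%N ->
  zdn m (z m) (z m.+1) i = z i.
Proof.
move=> rel; elim=> [|m IH] i; first by case: i => [|[]].
rewrite leq_eqVlt => /orP [/eqP ->|im]; first by rewrite zdn_top.
rewrite /= (ltn_eqF im); have /eqP := rel m.+1 isT.
by rewrite subr_eq0 => /eqP ->; apply: IH.
Qed.
End DownSequence.

Lemma rmorph_zdn (R S : comPzRingType) (f : {rmorphism R -> S}) x y m u v i :
  f (zdn x y m u v i) = zdn (f x) (f y) m (f u) (f v) i.
Proof.
elim: m u v => [|m IH] u v /=; first by case: eqP.
by case: eqP => // _; rewrite IH rmorphD !rmorphM !rmorphXn.
Qed.

Section BothSequence.
Variables (F : fieldType) (x y : F) (x0 : x != 0) (n : nat) (u v : F).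

(* The pair of the terms of indices [n + j] and [n + j + 1]. *)
Fixpoint zup j : F * F := if j is j'.+1 then
    let: (a, b) := zup j' in
    (b, (a - y ^+ (s (n + j').+2).-1 * b ^+ (s (n + j').+2)) / x)
  else (u, v).

Definition zboth i := if (i <= n)%N then zdn x y n u v i else (zup (i - n)).1.

Lemma zup_rel j : x * (zup j.+2).1 + y ^+ (s (n + j).+2).-1 * (zup j.+1).1 ^+ (s (n + j).+2)
  - (zup j).1 = 0.
Proof.
by rewrite /=; case: (zup j) => a b /=; rewrite mulrC divfK // subrK subrr.
Qed.

Lemma zboth_up j : zboth (n + j) = (zup j).1.
Proof.
rewrite /zboth; case: j => [|j]; first by rewrite addn0 leqnn zdn_next.
by rewrite leqNgt addnS ltnS leq_addr -addnS addKn.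
Qed.

Lemma zboth_down i : (i <= n.+1)%N -> zboth i = zdn x y n u v i.
Proof.
rewrite /zboth leq_eqVlt => /orP [/eqP ->|]; last by rewrite ltnS => ->.
by rewrite ltnn subSnn zdn_top.
Qed.

Lemma zboth_rel : B_rel x y zboth.
Proof.
move=> i i0; case: (leqP i n) => [le|lt].
  have le1 : (i <= n.+1)%N by apply: leqW.
  have le2 : (i.-1 <= n.+1)%N by apply: leq_trans (leq_pred i) _.
  by rewrite !zboth_down // zdn_rel // i0.
have -> : i = (n + (i - n).-1.+1)%N by rewrite prednK ?subn_gt0 // subnKC // ltnW.
by have := zup_rel (i - n).-1; rewrite -!zboth_up !addnS.
Qed.

Lemma zboth_n : zboth n = u. Proof. by rewrite /zboth leqnn zdn_next. Qed.
Lemma zboth_Sn : zboth n.+1 = v. Proof. by rewrite zboth_down // zdn_top. Qed.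
End BothSequence.

(** * Growth of s, substitution of monomials and dependence of powers *)

Lemma s_ge2 n : (0 < n)%N -> (2 <= s n)%N.
Proof.
have [m] := ubnP n; elim: m n => // m IH n nm n0.
case: n nm n0 => [|[|[|n]]] // nm _; rewrite sS //.
rewrite -[2%N]muln1 leq_mul //.
rewrite big_seq_cond prodn_cond_gt0 // => i; rewrite mem_index_iota andbT.
case/andP => i1 i2; apply: ltnW; apply: IH => //.
by apply: leq_trans i2 _; rewrite -ltnS ltnW.
Qed.

(** Each factor is at least 2. For [i = 0] this is the inequality between [N] and the degree on
    which the separation argument rests. *)
Lemma prod_s_gt n i : (n < \prod_(j < n) s (i + j).+2)%N.
Proof.
elim: n => [|n IH]; first by rewrite big_ord0.
rewrite big_ord_recr /=; apply: leq_ltn_trans IH _.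
rewrite ltn_Pmulr ?s_ge2 //; rewrite prodn_gt0 // => j.
by apply: ltnW; apply: s_ge2.
Qed.

Section MonomialSubstitution.
Variable R : idomainType.

Lemma coef_ev1_monomial (c : R) M (q : {poly R}) j : (0 < M)%N ->
  (ev1 (@polyC R) (c%:P * 'X^M) q)`_j =
  if (M %| j)%N then c ^+ (j %/ M) * q`_(j %/ M) else 0.
Proof.
move=> M0; elim/poly_ind: q j => [|q a IH] j.
  by rewrite rmorph0 coef0 coef0 mulr0 if_same.
rewrite rmorphD rmorphM /= ev1X ev1C [_ * (c%:P * _)]mulrCA coefD coefCM coefMXn coefC.
rewrite coefD coefMX coefC.
have [jM|jM] := ltnP j M.
  case: j jM => [|j] jM; first by rewrite dvdn0 div0n /= mulr0 mul1r.
  by rewrite gtnNdvd // mulr0 add0r.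
have j0 : j != 0%N by rewrite -lt0n (leq_trans M0).
rewrite (negbTE j0) addr0 IH.
have -> : (j %/ M = ((j - M) %/ M).+1)%N by rewrite -{1}(subnK jM) divnDr // divnn M0 addn1.
have -> : (M %| j)%N = (M %| j - M)%N by rewrite -{1}(subnK jM) dvdn_addl.
by rewrite /= addr0; case: ifP; rewrite ?mulr0 // exprS mulrA.
Qed.

(* The monomials [u^l t^i] with [i < N] are sent to monomials of pairwise
   distinct degrees [b (i + N l)]. *)
Lemma monomial_substitution_inj (c d : R) N b (G : {poly {poly R}}) :
  c != 0 -> d != 0 -> (0 < b)%N -> (size G <= N)%N ->
  ev1 (ev1 (@polyC R) (c%:P * 'X^(N * b))) (d%:P * 'X^b) G = 0 -> G = 0.
Proof.
move=> c0 d0 b0 GN G0; apply/polyP => i; rewrite coef0.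
have [iN|iN] := ltnP i N; last by rewrite nth_default // (leq_trans GN).
have N0 : (0 < N)%N by apply: leq_trans iN.
have Nb0 : (0 < N * b)%N by rewrite muln_gt0 N0.
apply/polyP => l; rewrite coef0.
have := congr1 (fun p : {poly R} => p`_(b * (i + N * l))) G0.
rewrite coef0 /ev1 (@horner_coef_wide _ N); last first.
  exact: leq_trans (size_poly _ _) GN.
rewrite coef_sum (bigD1 (Ordinal iN)) //= [X in _ + X]big1 => [|j ji].
  rewrite addr0 coef_map /= exprMn -exprM -rmorphXn /= mulrCA coefCM coefMXn.
  rewrite mulnDr ltnNge leq_addr /= addKn.
  have -> : (b * (N * l) = l * (N * b))%N by rewrite mulnCA mulnA mulnC.
  rewrite (coef_ev1_monomial _ _ _ Nb0) dvdn_mull // mulnK // => /eqP.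
  by rewrite !mulf_eq0 !expf_eq0 (negbTE c0) (negbTE d0) !andbF /= => /eqP.
(* The coefficient of index [j] contributes in degree [b * (i + N * l)] only if [i] and [j] are
   congruent modulo [N]; both being less than [N], they are then equal. *)
rewrite coef_map /= exprMn -exprM -rmorphXn /= mulrCA coefCM coefMXn.
case: ltnP => [|le]; first by rewrite mulr0.
rewrite (coef_ev1_monomial _ _ _ Nb0) -mulnBr [(b * (_ - _))%N]mulnC dvdn_pmul2r //.
case: ifP; last by rewrite mulr0.
rewrite -eqn_mod_dvd; last by rewrite -(leq_pmul2l b0).
rewrite addnC mulnC modnMDl !modn_small // => /eqP E.
by case/eqP: ji; apply: val_inj.
Qed.
End MonomialSubstitution.

Section PowerRelation.
Import Pdiv.Idomain.
Variable R : idomainType.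

(* The powers [H^0, ..., H^d], [d = deg F], are linearly dependent modulo [F]. *)
Lemma power_relation (F H : {poly R}) : F != 0 ->
  exists A Q : {poly R}, [/\ A != 0, (size A <= size F)%N & A \Po H = Q * F].
Proof.
move=> F0; have : (0 < size F)%N by rewrite size_poly_gt0.
case D: (size F) => [|d] // _.
have remF n : (size (H ^+ n %% F)%R <= d)%N by rewrite -ltnS -D ltn_modp.
pose M : 'M[R]_d.+1 := \matrix_(i, j) (H ^+ i %% F)`_j.
(* The remainders have degree less than [d], so the last column of this square matrix of order
   [d + 1] vanishes. *)
have detM : \det M == 0.
  rewrite (expand_det_col _ ord_max) big1 // => i _.
  by rewrite mxE nth_default ?mul0r // remF.
have [v v0 vM] := det0P detM.
(* Over a domain only pseudo-division is available: it divides [H ^+ i] multiplied by this power of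
   the leading coefficient. *)
pose A := \poly_(i < d.+1) (v 0 (inord i) * lead_coef F ^+ scalp (H ^+ i) F).
have AiE (i : 'I_d.+1) : A`_i = v 0 i * lead_coef F ^+ scalp (H ^+ i) F.
  by rewrite coef_poly ltn_ord inord_val.
exists A, (\sum_(i < d.+1) v 0 i *: (H ^+ i %/ F)); split.
- have [i vi] : exists i, v 0 i != 0.
    apply/existsP; apply: contraNT v0 => /existsPn v0.
    by apply/eqP/rowP => i; rewrite mxE; apply/eqP; have := v0 i; rewrite negbK.
  apply/eqP => A0; have /eqP := AiE i; rewrite A0 coef0 eq_sym mulf_eq0 (negbTE vi) /=.
  by rewrite expf_eq0 lead_coef_eq0 (negbTE F0) andbF.
- exact: size_poly.
rewrite /comp_poly (@horner_coef_wide _ d.+1); last first.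
  by apply: leq_trans (size_poly _ _) _; apply: size_poly.
have E : \sum_(i < d.+1) v 0 i *: (H ^+ i %% F) = 0.
  apply/polyP => j; rewrite coef0 coef_sum.
  have [jd|jd] := ltnP j d.+1.
    have vMj : (v *m M) 0 (Ordinal jd) = 0 by rewrite vM mxE.
    rewrite -[RHS]vMj mxE; apply: eq_bigr => i _; rewrite coefZ mxE.
    by [].
  apply: big1 => i _; rewrite coefZ nth_default ?mulr0 //.
  by apply: leq_trans (remF i) (ltnW jd).
rewrite mulr_suml -[RHS]addr0 -[X in _ + X]E -big_split /=; apply: eq_bigr => i _.
rewrite coef_map /= AiE mul_polyC -scalerA divp_eq scalerDr.
by rewrite -scalerAl.
Qed.
End PowerRelation.

Lemma dvdr_polyC_coef (R : comNzRingType) (a : R) (p : {poly R}) :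
  (forall i, dvdr a p`_i) -> dvdr a%:P p.
Proof.
elim/poly_ind: p => [|p c IH] h; first by exists 0; rewrite mulr0.
have [|q ->] := IH.
  by move=> i; have := h i.+1; rewrite coefD coefMX coefC /= addr0.
have [d] := h 0%N; rewrite coefD coefMX coefC /= add0r => ->.
by exists (q * 'X + d%:P); rewrite mulrDr mulrA polyCM.
Qed.

(** Here the inner variable is divided out; the size of the leading coefficient drops each time. *)
Lemma polyX_content (R : idomainType) (G : {poly {poly R}}) : G != 0 ->
  exists e G', [/\ G = 'X%:P ^+ e * G', size G' = size G & ~ dvdr 'X%:P G'].
Proof.
have [n] := ubnP (size (lead_coef G)); elim: n G => // n IH G.
rewrite ltnS => Gn G0.
case: (classic (dvdr 'X%:P G)) => [[G1 GE]|]; last first.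
  by exists 0%N, G; rewrite mul1r.
have G10 : G1 != 0 by apply: contraNneq G0 => G10; rewrite GE G10 mulr0.
have [||e [G' [G1E Gs nX]]] := IH G1 => //.
  apply: leq_trans Gn; rewrite GE lead_coefM lead_coefC mulrC size_mulX //.
  by rewrite lead_coef_eq0.
exists e.+1, G'; split=> //; first by rewrite exprS -mulrA -G1E.
by rewrite Gs GE mul_polyC size_scale // polyX_eq0.
Qed.

Lemma factorial_P4 (k : fieldType) : factorial_ring (P4 k).
Proof. by do 4 apply: factorial_poly; apply: factorial_field. Qed.

Lemma prime_vX (k : fieldType) : prime_elt (vX k).
Proof. rewrite vX.unlock; exact/prime_polyC/prime_polyX. Qed.

Lemma prime_vY (k : fieldType) : prime_elt (vY k).
Proof. rewrite vY.unlock; exact/prime_polyC/prime_polyC/prime_polyC/prime_polyX. Qed.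

Lemma vX_content (k : fieldType) (G : P4 k) : G != 0 ->
  exists e G', [/\ G = vX k ^+ e * G', size G' = size G & ~ dvdr (vX k) G'].
Proof. rewrite vX.unlock; exact: polyX_content. Qed.

Lemma not_dvdr_vX_vY (k : fieldType) : ~ dvdr (vX k) (vY k).
Proof.
rewrite vX.unlock vY.unlock; case/dvdr_polyC => q /(congr1 (fun p : {poly P2 k} => p`_0)).
by rewrite coefXM coefC /= => /eqP; rewrite polyC_eq0 polyX_eq0.
Qed.

(** * Structure of B as a union of polynomial rings *)

Section Structure.
Variables (k : fieldType) (B : comNzRingType) (iota : {rmorphism k -> B}).
Variables (x y : B) (Z : nat -> B).
Hypothesis HB : presents_B iota x y Z.

Let rel : B_rel x y Z := HB.1.
Definition evn n : {rmorphism P4 k -> B} := ev4 iota y (Z n) x (Z n.+1).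

(** The sequence [zboth] gives a morphism from [B] to the fraction field of [P4 k], whose
    composition with [evn n] is the canonical inclusion. *)
Lemma evn_inj n : injective (evn n).
Proof.
pose tof : {rmorphism P4 k -> {fraction P4 k}} := @FracField.tofrac (P4 k).
have X0 : tof (vX k) != 0 by rewrite /tof /= tofrac_eq0; case: (prime_vX k).
have [g [gi gx gy gZ _]] := HB.2 _ (tof \o vC k) _ _ _
  (zboth_rel (tof (vY k)) X0 n (tof (vU k)) (tof (vT k))).
have gE p : g (evn n p) = tof p.
  rewrite -[in RHS](ev4_id p) /evn !rmorph_ev4 gy gx !gZ zboth_n zboth_Sn.
  by apply: eq_ev4 => c; apply: gi.
by move=> p q /(congr1 g); rewrite !gE => /eqP; rewrite /tof /= tofrac_eq => /eqP.
Qed.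

Lemma gen_ind (P : B -> Prop) : (forall c, P (iota c)) -> P x -> P y ->
  (forall i, P (Z i)) -> (forall a b, P a -> P b -> P (a - b)) ->
  (forall a b, P a -> P b -> P (a * b)) -> forall b, P b.
Proof.
by move=> ? ? ? ? ? ? b; elim: (presents_generated HB b) => *; auto.
Qed.

Lemma evn_vC m c : evn m (vC k c) = iota c. Proof. exact: ev4C. Qed.
Lemma evn_vX m : evn m (vX k) = x. Proof. exact: ev4X. Qed.
Lemma evn_vY m : evn m (vY k) = y. Proof. exact: ev4Y. Qed.
Lemma evn_vU m : evn m (vU k) = Z m. Proof. exact: ev4U. Qed.
Lemma evn_vT m : evn m (vT k) = Z m.+1. Proof. exact: ev4T. Qed.
Definition evnE := (evn_vC, evn_vX, evn_vY, evn_vU, evn_vT).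

Lemma evn_zdn m i : (i <= m.+1)%N ->
  evn m (zdn (vX k) (vY k) m (vU k) (vT k) i) = Z i.
Proof. by move=> im; rewrite rmorph_zdn !evnE zdn_unique. Qed.

(** Asking for all large [m] lets finitely many elements be lifted to a common level. *)
Lemma evn_surj b : exists m0, forall m, (m0 <= m)%N -> exists p, evn m p = b.
Proof.
elim/gen_ind: b => [c|||i|a b [m ma] [n nb]|a b [m ma] [n nb]].
- by exists 0%N => m _; exists (vC k c); rewrite evnE.
- by exists 0%N => m _; exists (vX k); rewrite evnE.
- by exists 0%N => m _; exists (vY k); rewrite evnE.
- exists i => m im; exists (zdn (vX k) (vY k) m (vU k) (vT k) i).
  by rewrite evn_zdn // leqW.
- exists (maxn m n) => l; rewrite geq_max => /andP [/ma [p pE] /nb [q qE]].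
  by exists (p - q); rewrite rmorphB pE qE.
- exists (maxn m n) => l; rewrite geq_max => /andP [/ma [p pE] /nb [q qE]].
  by exists (p * q); rewrite rmorphM pE qE.
Qed.

Lemma evn_surj_seq (l : seq B) : exists m0, forall m, (m0 <= m)%N ->
  forall b, b \in l -> exists p, evn m p = b.
Proof.
elim: l => [|a l [n IH]]; first by exists 0%N.
have [m ma] := evn_surj a; exists (maxn m n) => j.
rewrite geq_max => /andP [/ma ja /IH jl] b.
by rewrite inE => /orP [/eqP ->|/jl].
Qed.

Lemma B_integral : integral_domain B.
Proof.
split; first exact: oner_neq0.
move=> a b ab; have [m h] := evn_surj_seq [:: a; b].
have [||p pE] := h m _ a; rewrite ?inE ?eqxx //.
have [||q qE] := h m _ b; rewrite ?inE ?eqxx ?orbT //.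
move: ab; rewrite -pE -qE -rmorphM -(rmorph0 (evn m)) => /evn_inj /eqP.
by rewrite mulf_eq0 => /orP [] /eqP ->; [left|right].
Qed.

(** Meant for [vX] and [vY], whose images are the same at all levels: once the level contains the
    quotient, injectivity brings the equation back to [P4 k]. *)
Lemma evn_dvdr (c : P4 k) (b : B) : (forall m, evn m c = b) ->
  forall d, dvdr b d -> exists m0, forall m, (m0 <= m)%N -> forall q, evn m q = d -> dvdr c q.
Proof.
move=> cb d [a ->]; have [m0 h] := evn_surj a; exists m0 => m /h [p <-] q.
by rewrite -(cb m) -rmorphM => /evn_inj ->; exists p.
Qed.

Lemma prime_evn (c : P4 k) (b : B) : (forall m, evn m c = b) ->
  prime_elt c -> prime_elt b.
Proof.
move=> cb [c0 [cu cp]]; split.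
  by apply: contraNneq c0 => b0; apply/eqP/(@evn_inj 0); rewrite cb b0 rmorph0.
split.
  case=> v bv; have [|m0 h] := evn_dvdr cb (d := 1); first by exists v.
  by have [|w cw] := h m0 _ 1 (rmorph1 _) => //; apply: cu; exists w.
move=> d e /(evn_dvdr cb) [m0 h]; have [m1 h1] := evn_surj_seq [:: d; e].
pose m := maxn m0 m1.
have [||p pE] := h1 m _ d; rewrite ?inE ?eqxx ?leq_maxr //.
have [||q qE] := h1 m _ e; rewrite ?inE ?eqxx ?orbT ?leq_maxr //.
have /cp [[r rE]|[r rE]] : dvdr c (p * q).
- by apply: (h m); rewrite ?leq_maxl // rmorphM pE qE.
- by left; exists (evn m r); rewrite -pE rE rmorphM cb.
- by right; exists (evn m r); rewrite -qE rE rmorphM cb.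
Qed.


Lemma prime_x : prime_elt x. Proof. exact: prime_evn evn_vX (prime_vX k). Qed.
Lemma prime_y : prime_elt y. Proof. exact: prime_evn evn_vY (prime_vY k). Qed.

Lemma not_dvdr_x_y : ~ dvdr x y.
Proof.
by case/(evn_dvdr evn_vX) => m /(_ m (leqnn m) _ (evn_vY m)) /not_dvdr_vX_vY.
Qed.

Lemma x_denominator b : exists N p, evn 0 p = x ^+ N * b.
Proof.
have mono N N' p b' : (N <= N')%N -> evn 0 p = x ^+ N * b' ->
    evn 0 (vX k ^+ (N' - N) * p) = x ^+ N' * b'.
  by move=> le E; rewrite rmorphM rmorphXn evn_vX E mulrA -exprD subnK.
have sub a b' : (exists N p, evn 0 p = x ^+ N * a) ->
    (exists N p, evn 0 p = x ^+ N * b') -> exists N p, evn 0 p = x ^+ N * (a - b').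
  move=> [N [p pE]] [N' [q qE]]; exists (maxn N N').
  exists (vX k ^+ (maxn N N' - N) * p - vX k ^+ (maxn N N' - N') * q).
  by rewrite rmorphB (mono _ _ _ _ _ pE) ?leq_maxl // (mono _ _ _ _ _ qE) ?leq_maxr // mulrBr.
have mul a b' : (exists N p, evn 0 p = x ^+ N * a) ->
    (exists N p, evn 0 p = x ^+ N * b') -> exists N p, evn 0 p = x ^+ N * (a * b').
  move=> [N [p pE]] [N' [q qE]]; exists (N + N')%N, (p * q).
  by rewrite rmorphM pE qE mulrACA exprD.
have base p b' : evn 0 p = b' -> exists N p, evn 0 p = x ^+ N * b'.
  by move=> E; exists 0%N, p; rewrite mul1r.
have hx := base _ _ (evn_vX 0); have hy := base _ _ (evn_vY 0).
have pow a n : (exists N p, evn 0 p = x ^+ N * a) -> exists N p, evn 0 p = x ^+ N * a ^+ n.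
  move=> ha; elim: n => [|n IH]; first exact: base (rmorph1 _).
  by rewrite exprS; apply: mul.
elim/gen_ind: b => [c|||i|a b|a b] //.
- by apply: (base (vC k c)); rewrite evnE.
(* Two consecutive terms are carried along, since the relation expresses [x * Z j.+2] through [Z j]
   and [Z j.+1]. *)
- suff H j : (exists N p, evn 0 p = x ^+ N * Z j) /\
      (exists N p, evn 0 p = x ^+ N * Z j.+1) by have [] := H i.
  elim: j => [|j [IH1 IH2]].
    by split; [apply: (base (vU k))|apply: (base (vT k))]; rewrite evnE.
  split=> //; have := rel (isT : (0 < j.+1)%N) => /= /eqP.
  rewrite -addrA addrC addr_eq0 eq_sym => /eqP E.
  have [N [p pE]] : exists N p, evn 0 p = x ^+ N * (x * Z j.+2).
    have -> : x * Z j.+2 = Z j - y ^+ (s j.+2).-1 * Z j.+1 ^+ s j.+2.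
      by apply/eqP; rewrite -subr_eq0 opprB addrA rel.
    by apply: sub => //; apply: mul; apply: pow.
  by exists N.+1, p; rewrite exprSr -mulrA.
- exact: sub.
- exact: mul.
Qed.
End Structure.

(** * Separation by the powers of x, and factoriality *)

Section ReductionModX.
Variable k : fieldType.

(* Reduction modulo [x] followed by evaluation: [y] is kept, [u] and [t] are
   sent to monomials in a new variable ['X : P2 k]. *)
Definition red (u t : P2 k) : {rmorphism P4 k -> P2 k} :=
  ev4 (C2 k \o C1 k) (C2 k 'X) u 0 t.

Lemma ev1_0 (R S : comNzRingType) (f : {rmorphism R -> S}) (q : {poly R}) :
  ev1 f 0 q = f q`_0.
Proof. by rewrite /ev1 horner_coef0 coef_map. Qed.

Lemma e1_C2 p : e1 (C2 k \o C1 k) (C2 k 'X) p = C2 k p.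
Proof. symmetry; exact: (rmorph_poly_ev1 (g := C2 k)). Qed.

(** The polynomial [G0], which is [G] modulo [x], vanishes under an injective monomial substitution;
    so every coefficient of [G] has zero constant term in [x]. *)
Lemma red_monomial_inj (c d : P1 k) N b (G : P4 k) :
  c != 0 -> d != 0 -> (0 < b)%N -> (size G <= N)%N ->
  red (c%:P * 'X^(N * b)) (d%:P * 'X^b) G = 0 -> dvdr (vX k) G.
Proof.
move=> c0 d0 b0 GN redG; rewrite vX.unlock; apply: dvdr_polyC_coef => i.
suff : G`_i`_0 = 0 by move/poly_coef0_eq0 => [q ->]; exists q; rewrite mulrC.
pose G0 : {poly P2 k} := map_poly (ev1 (@idfun (P2 k)) 0) G.
have -> : G`_i`_0 = G0`_i by rewrite coef_map /= ev1_0.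
rewrite (_ : G0 = 0) ?coef0 //.
apply: (monomial_substitution_inj (N := N) c0 d0 b0).
  exact: leq_trans (size_poly _ _) GN.
rewrite -redG /red /ev4 [in LHS]/ev1 [in RHS]/ev1 -map_poly_comp; congr _.[_].
apply: eq_map_poly => q /=; rewrite !ev1_0 /=.
rewrite /e2 /= /ev1; congr _.[_]; apply: eq_map_poly => p.
by rewrite e1_C2.
Qed.
End ReductionModX.

Lemma ev1_comp_poly (R S : comNzRingType) (f : {rmorphism R -> S}) a (A H : {poly R}) :
  ev1 f a (A \Po H) = ev1 f (ev1 f a H) A.
Proof.
elim/poly_ind: A => [|A c IH]; first by rewrite comp_poly0 !rmorph0.
by rewrite comp_polyD comp_polyM comp_polyX comp_polyC !rmorphD !rmorphM /= IH !ev1C ev1X.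
Qed.

Section MonomialChain.
Variables (R : comNzRingType) (y : R) (z : nat -> R).

Lemma chain_power i n :
  (forall j, (j < n)%N ->
    z (i + j)%N = y ^+ (s (i + j).+2).-1 * z (i + j).+1 ^+ s (i + j).+2) ->
  exists a, z i = y ^+ a * z (i + n)%N ^+ \prod_(j < n) s (i + j).+2.
Proof.
elim: n => [|n IH] h.
  by exists 0%N; rewrite big_ord0 addn0 mul1r expr1.
have [j jn|a ->] := IH; first by apply: h; apply: ltnW.
rewrite big_ord_recr /= h // exprMn -!exprM mulrA -exprD -addnS.
set N := (\prod_(_ < _) _)%N; rewrite [(s _ * N)%N]mulnC.
by eexists.
Qed.
End MonomialChain.

Section Separation.
Variables (k : fieldType) (B : comNzRingType) (iota : {rmorphism k -> B}).
Variables (x y : B) (Z : nat -> B).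
Hypothesis HB : presents_B iota x y Z.

Let dom := B_integral HB.
Let px := prime_x HB.
Let x0 : x != 0 := px.1.

Definition x_divisible (b : B) := forall m, dvdr (x ^+ m) b.

Lemma x_divisible_mul a b : x_divisible b -> x_divisible (a * b).
Proof. by move=> h m; apply: dvdr_mull. Qed.

Lemma x_divisible_cancel e b : x_divisible (x ^+ e * b) -> x_divisible b.
Proof.
move=> h m; have [c E] := h (e + m)%N; exists c.
by apply: (domI dom (dom_exp_neq0 dom e x0)); rewrite E exprD mulrA.
Qed.

(** The value at [Z n] of a polynomial in [vT] over k[x, y, Z_0]. *)
Definition evz n : {rmorphism P4 k -> B} := ev4 iota y (Z 0) x (Z n).

(** For [x = 0] each term is a monomial in [y] and the next term. Descending from ['X] at index [m]
    gives [b = s(n+2) ... s(m+1)] at index [n], and the further factor [s(2) ... s(n+1)] at index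
    0. *)
Lemma zdn_red m n : (n <= m)%N -> exists a b c,
  let z : nat -> P2 k := zdn 0 (C2 k 'X) m 'X 0 in
  [/\ (0 < b)%N, z 0%N = ('X^a)%:P * 'X^((\prod_(j < n) s j.+2) * b) &
      z n = ('X^c)%:P * 'X^b].
Proof.
move=> nm; pose z : nat -> P2 k := zdn 0 (C2 k 'X) m 'X 0.
have step j : (j < m)%N ->
    z j = C2 k 'X ^+ (s j.+2).-1 * z j.+1 ^+ s j.+2.
  move=> jm; have := @zdn_rel _ 0 (C2 k 'X) m 'X 0 j.+1.
  rewrite /= jm => /(_ isT) /eqP; rewrite mul0r add0r subr_eq0 => /eqP.
  by rewrite /z => ->.
have zm : z m = 'X by rewrite /z zdn_next.
have [|c] := @chain_power _ (C2 k 'X) z n (m - n).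
  by move=> j jmn; apply: step; rewrite -ltn_subRL.
rewrite subnKC // zm; set b := (\prod_(_ < _) _)%N => znE.
have [|a] := @chain_power _ (C2 k 'X) z 0 n.
  by move=> j jn; rewrite !add0n; apply: step; apply: leq_trans nm.
rewrite add0n znE exprMn -!exprM mulrA -exprD => z0E.
have polyCX e : ('X^e)%:P = C2 k 'X ^+ e :> P2 k by rewrite -rmorphXn.
exists (a + c * \prod_(j < n) s j.+2)%N, b, c; split; rewrite ?polyCX -/z.
- by rewrite prodn_gt0 // => j; apply: ltnW; apply: s_ge2.
- by rewrite [LHS]z0E [(b * _)%N]mulnC.
- exact: znE.
Qed.

(** At a level [m >= n] containing the quotient by [x], the divisibility becomes an equation in
    [P4 k]; reduced modulo [x], it says that [G] vanishes at the monomials of [zdn_red]. *)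
Lemma evz_x_divisible n (G : P4 k) :
  (size G <= \prod_(j < n) s j.+2)%N -> dvdr x (evz n G) -> dvdr (vX k) G.
Proof.
move=> Gn [b' E]; have [m0 h] := evn_surj HB b'.
pose m := maxn m0 n; have [|g gE] := h m; first exact: leq_maxl.
have nm : (n <= m)%N := leq_maxr _ _.
pose zeta i := zdn (vX k) (vY k) m (vU k) (vT k) i.
have GE : ev4 (vC k) (vY k) (zeta 0%N) (vX k) (zeta n) G = vX k * g.
  apply: (evn_inj HB (n := m)); rewrite rmorphM evnE gE -E /evz.
  rewrite (rmorph_ev4 _ (evn iota x y Z m)) !evnE !(evn_zdn HB) //; last exact: leqW.
  by apply: eq_ev4 => c; rewrite /= evnE.
have [a [b [c [b0 z0E znE]]]] := zdn_red nm.
have Xe0 e : ('X : P1 k) ^+ e != 0 by rewrite expf_neq0 // polyX_eq0.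
apply: (red_monomial_inj (Xe0 a) (Xe0 c) b0 Gn).
have /= E0 := congr1 (red ('X : P2 k) 0) GE.
rewrite (rmorph_ev4 _ (red 'X 0)) rmorphM {3}/red ev4X mul0r in E0.
apply: etrans E0; rewrite -z0E -znE.
rewrite /zeta !(rmorph_zdn (red 'X 0)) /red !ev4X !ev4Y !ev4U !ev4T.
by apply: eq_ev4 => d; rewrite /= ev4C.
Qed.

Theorem x_separated b : b != 0 -> exists m, ~ dvdr (x ^+ m) b.
Proof.
move=> b0; apply: NNPP => /not_ex_all_not nb.
have Kb : x_divisible b by move=> m; apply: NNPP.
have [N [F FE]] := x_denominator HB b.
have F0 : F != 0.
  apply: contraNneq b0 => F0; move: FE; rewrite F0 rmorph0 => /esym /dom.2 [/eqP|->//].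
  by rewrite (negbTE (dom_exp_neq0 dom N x0)).
have KF : x_divisible (evn iota x y Z 0 F) by rewrite FE; apply: x_divisible_mul.
(* This index makes [s(2) ... s(n+1)] exceed the size of [F], which bounds that of [A], [G] and
   [G']. *)
pose n := size F.
have [M [H HE]] := x_denominator HB (Z n).
have [A [Q [A0 sA AE]]] := power_relation H F0.
have KA : x_divisible (ev4 iota y (Z 0) x (x ^+ M * Z n) A).
  have <- : evn iota x y Z 0 (A \Po H) = ev4 iota y (Z 0) x (x ^+ M * Z n) A.
    by rewrite -HE; apply: ev1_comp_poly.
  by rewrite AE rmorphM; apply: x_divisible_mul.
(* [G(T) = A(x^M T)], so that [G(Z_n)] is [A] evaluated at [x^M Z_n], the image of [H]. *)
pose G : P4 k := A \Po ((('X : P3 k) ^+ M) *: 'X).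
have XM0 : ('X : P3 k) ^+ M != 0 by rewrite expf_neq0 // polyX_eq0.
have sG : size G = size A.
  by rewrite size_comp_poly2 // size_scale // size_polyX.
have GE : evz n G = ev4 iota y (Z 0) x (x ^+ M * Z n) A.
  have <- : evz n (('X : P3 k) ^+ M *: 'X) = x ^+ M * Z n.
    rewrite -mul_polyC !rmorphM !rmorphXn; congr (_ ^+ _ * _); last exact: ev1X.
    exact: etrans (ev1C _ _ _) (ev1X _ _).
  exact: ev1_comp_poly.
have G0 : G != 0 by rewrite -size_poly_gt0 sG size_poly_gt0.
have [e [G' [GG' sG' nG']]] := vX_content G0.
apply: nG'; apply: (@evz_x_divisible n).
  rewrite sG' sG (leq_trans sA) // ltnW //.
  by have := prod_s_gt n 0.
have : x_divisible (evz n G') .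
  apply: (@x_divisible_cancel e); rewrite -[x ^+ e](_ : evz n (vX k ^+ e) = _).
    by rewrite -rmorphM -GG' GE.
  by rewrite rmorphXn /evz ev4X.
by move/(_ 1%N).
Qed.
(** Nagata's criterion with [x] as the only prime: [x_separated] bounds the power of [x] dividing
    [b]. After inverting [x], by [x_denominator], [B] becomes a localisation of the factorial ring
    [P4 k], embedded by [evn 0]. *)
Theorem factorial_B : factorial_ring B.
Proof.
have Qprime q : q = x -> prime_elt q by move=> ->.
have multx n : multQ (fun q => q = x) (x ^+ n).
  exists 1, (nseq n x); split; first exact: unitr_one.
    by move=> q /nseqP [].
  by rewrite mul1r big_nseq; elim: n => [|n IH]; rewrite ?expr0 // exprS IH.
apply: (nagata dom Qprime) => b b0.
  have [m nm] := x_separated b0.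
  have : exists j, ~ dvdr (x ^+ j.+1) b /\ dvdr (x ^+ j) b.
    elim: m nm => [|m IH] nm; first by case: nm; exists b; rewrite mul1r.
    by case: (classic (dvdr (x ^+ m) b)) => [h|/IH //]; exists m.
  case=> j [nj [b' bE]]; exists (x ^+ j) => //; exists b' => // q -> [c b'E].
  by case: nj; exists c; rewrite bE b'E mulrA exprSr.
have [N [p pE]] := x_denominator HB b.
have p0 : p != 0.
  apply: contraNneq b0 => p0; move: pE; rewrite p0 rmorph0 => /esym /dom.2 [/eqP|->//].
  by rewrite (negbTE (dom_exp_neq0 dom N x0)).
have [u [l [[v uv] lp pl]]] := factorial_P4 p0.
exists (x ^+ N) => //; exists (map (evn iota x y Z 0) (u :: l)); last first.
  by rewrite -pE pl big_map big_cons rmorphM rmorph_prod.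
have unitQ w c d : unitr w -> dvdQ (fun q => q = x) w c \/ dvdQ (fun q => q = x) w d.
  by move=> uw; left; exists 1; [exact: multQ1|exact: unitr_dvd].
move=> q /mapP [r]; rewrite inE => /orP [/eqP -> ->|rl ->].
  have uu : unitr (evn iota x y Z 0 u).
    by exists (evn iota x y Z 0 v); rewrite -rmorphM uv rmorph1.
  by split; [exact: unitr_neq0|move=> c d _; apply: unitQ].
have [r0 [nr rdiv]] := lp _ rl; split.
  by apply: contraNneq r0 => E; apply/eqP/(evn_inj HB (n := 0)); rewrite E rmorph0.
move=> c d [_ [w [m [[w' ww'] mx ->]]]].
have {m mx} [j ->] : exists j, \prod_(q0 <- m) q0 = x ^+ j.
  elim: m mx => [|a m IH] mx; first by exists 0%N; rewrite big_nil.
  have [|j E] := IH; first by move=> a' a'm; apply: mx; rewrite inE a'm orbT.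
  by exists j.+1; rewrite big_cons E (mx a) ?mem_head // exprS.
case=> e E.
have [N1 [c1 c1E]] := x_denominator HB c.
have [N2 [d1 d1E]] := x_denominator HB d.
have [N3 [e1 e1E]] := x_denominator HB (w' * e).
(* Multiplication by powers of [x] brings the divisibility down to level 0, where [r] is prime. *)
have : dvdr r (vX k ^+ (N3 + j) * (c1 * d1)).
  exists (vX k ^+ (N1 + N2) * e1); apply: (evn_inj HB (n := 0)).
  rewrite !rmorphM !rmorphXn !evnE c1E d1E e1E !exprD.
  set R := evn _ _ _ _ _ r in E *.
  have E2 : x ^+ j * (c * d) = w' * (R * e).
    by rewrite -E !mulrA [w' * w]mulrC ww' mul1r.
  have -> : x ^+ N3 * x ^+ j * (x ^+ N1 * c * (x ^+ N2 * d)) =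
    x ^+ N1 * x ^+ N2 * x ^+ N3 * (x ^+ j * (c * d)) by ring.
  by rewrite E2; ring.
have dvdx a N' a1 : evn iota x y Z 0 a1 = x ^+ N' * a -> dvdr r a1 ->
    dvdQ (fun q => q = x) (evn iota x y Z 0 r) a.
  move=> aE [q' a1E]; exists (x ^+ N') => //; exists (evn iota x y Z 0 q').
  by rewrite -aE a1E rmorphM.
case/rdiv => [|/rdiv [|]]; [|by left; apply: dvdx c1E _|by right; apply: dvdx d1E _].
(* In this case [r] divides [vX]: its image becomes a unit once [x] is inverted. *)
move/(prime_dvd_exp (lp _ rl)) => [q' xE].
left; exists x; first by rewrite -[x]expr1.
by apply: dvdr_mulr; exists (evn iota x y Z 0 q'); rewrite -rmorphM -xE evnE.
Qed.
End Separation.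

(** * Transcendence degree, ideals *)

Lemma rmorph_mmap n (k R S : comNzRingType) (f : {rmorphism k -> R})
    (g : {rmorphism R -> S}) (v : 'I_n -> R) (p : {mpoly k[n]}) :
  g (mmap f v p) = mmap (g \o f) (g \o v) p.
Proof.
rewrite /mmap rmorph_sum; apply: eq_bigr => m _; rewrite rmorphM; congr (_ * _).
by rewrite /mmap1 rmorph_prod; apply: eq_bigr => i _; rewrite rmorphXn.
Qed.

Lemma eq_mmap n (k S : comNzRingType) (f g : k -> S) (v w : 'I_n -> S)
    (p : {mpoly k[n]}) : f =1 g -> v =1 w -> mmap f v p = mmap g w p.
Proof.
move=> fg vw; rewrite /mmap; apply: eq_bigr => m _; rewrite fg; congr (_ * _).
exact: mmap1_eq.
Qed.

Lemma mmap_id n (k : comNzRingType) (p : {mpoly k[n]}) :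
  mmap (@mpolyC n k) (fun i => 'X_i) p = p.
Proof.
rewrite [RHS]mpolyE /mmap; apply: eq_bigr => m _.
by rewrite mmap1_id mul_mpolyC.
Qed.

Lemma msize_prod_le n (k : idomainType) N (F : 'I_N -> {mpoly k[n]}) d :
  (forall i, (msize (F i)).+1 <= d)%N -> ((msize (\prod_(i < N) F i)).+1 <= d * N + 2)%N.
Proof.
elim: N F => [|N IH] F h; first by rewrite big_ord0 msize1 muln0.
rewrite big_ord_recr /=; apply: leq_ltn_trans (msizeM_le _ _) _.
have addSS a b : (a + b).+2 = (a.+1 + b.+1)%N by rewrite addSn addnS.
rewrite addSS mulnSr addnAC leq_add ?h //.
exact: IH.
Qed.

(* Counting: the [N^(n+1)] monomials of degree [< N] in each of the [n + 1]
   elements lie in a space of dimension [(C N)^n]. *)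
Lemma mpoly_alg_dependent n (k : fieldType) (g : 'I_n.+1 -> {mpoly k[n]}) :
  exists2 Q : {mpoly k[n.+1]}, Q != 0 & mmap (@mpolyC n k) g Q = 0.
Proof.
pose d := (\max_i msize (g i)).+1.
(* [C] is such that every product [F e] has size at most [C * N]; [N > C ^ n] then gives
   [N ^ n.+1 > (C * N) ^ n], so that the matrix [A] has more rows than columns. *)
pose C := ((d + 2) * n.+1 + 2)%N; pose N := (C ^ n).+1; pose M := (C * N)%N.
pose mon_s (e : {ffun 'I_n.+1 -> 'I_N}) : 'X_{1..n.+1} := [multinom (e l : nat) | l < n.+1].
pose mon_t (e : {ffun 'I_n -> 'I_M}) : 'X_{1..n} := [multinom (e l : nat) | l < n].
pose F (e : {ffun 'I_n.+1 -> 'I_N}) := \prod_l g l ^+ e l.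
have Fsize e : (msize (F e) <= M)%N.
  have : ((msize (F e)).+1 <= (d * N + 2) * n.+1 + 2)%N.
    apply: msize_prod_le => l; have -> : g l ^+ e l = \prod_(i < e l) g l.
      by rewrite prodr_const card_ord.
    apply: leq_trans (msize_prod_le (d := d) _) _ => [i|].
      by rewrite ltnS; apply: leq_bigmax.
    by rewrite leq_add2r leq_mul2l ltnW ?orbT.
  move/ltnW/leq_trans; apply; rewrite /M /C [X in (_ <= X)%N]mulnDl leq_add ?leq_pmulr //.
  by rewrite [X in (_ <= X)%N]mulnAC leq_mul2r mulnDl leq_add2l leq_pmulr ?orbT.
pose A : 'M[k]_(#|{ffun 'I_n.+1 -> 'I_N}|, #|{ffun 'I_n -> 'I_M}|) :=
  \matrix_(i, j) (F (enum_val i))@_(mon_t (enum_val j)).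
have : kermx A != 0.
  rewrite -mxrank_eq0 mxrank_ker subn_eq0 -ltnNge.
  apply: leq_ltn_trans (rank_leq_col _) _.
  rewrite !card_ffun !card_ord /M expnMn [(N ^ n.+1)%N]expnSr mulnC ltn_pmul2l //.
  by rewrite expn_gt0.
case/rowV0Pn => v /sub_kermxP vA v0.
have [i0 vi0] : exists i, v 0 i != 0.
  apply/existsP; apply: contraNT v0 => /existsPn v0.
  by apply/eqP/rowP => i; rewrite mxE; apply/eqP; have := v0 i; rewrite negbK.
exists (\sum_i v 0 i *: 'X_[mon_s (enum_val i)]).
  apply/eqP => /(congr1 (fun p => p@_(mon_s (enum_val i0)))).
  rewrite mcoeff0 raddf_sum (bigD1 i0) //= mcoeffZ mcoeffX eqxx mulr1.
  rewrite big1 ?addr0 => [/eqP|i ii0]; first by rewrite (negbTE vi0).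
  rewrite mcoeffZ mcoeffX; case: eqP => [E|]; last by rewrite mulr0.
  case/eqP: ii0; apply: enum_val_inj; apply/ffunP => l; apply: val_inj.
  by have := congr1 (fun m : 'X_{1..n.+1} => m l) E; rewrite !mnmE.
rewrite raddf_sum /=.
have -> : \sum_i mmap (@mpolyC n k) g (v 0 i *: 'X_[mon_s (enum_val i)]) =
    \sum_i v 0 i *: F (enum_val i).
  apply: eq_bigr => i _; rewrite mmapZ mmapX mul_mpolyC; congr (_ *: _).
  by apply: eq_bigr => l _; rewrite mnmE.
apply/mpolyP => m; rewrite mcoeff0 raddf_sum /=.
have [/forallP mM|/forallPn [l ml]] := boolP [forall l, (m l < M)%N]; last first.
  apply: big1 => i _; rewrite mcoeffZ memN_msupp_eq0 ?mulr0 //.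
  apply: msize_mdeg_ge; apply: leq_trans (Fsize _) _.
  rewrite -leqNgt in ml; apply: leq_trans ml _.
  by rewrite mdegE (bigD1 l) //= leq_addr.
pose j : {ffun 'I_n -> 'I_M} := [ffun l => Ordinal (mM l)].
have mE : m = mon_t j by apply/mnmP => l; rewrite mnmE ffunE.
have := congr1 (fun w : 'rV[k]__ => w 0 (enum_rank j)) vA; rewrite !mxE => vAj.
by rewrite -[RHS]vAj; apply: eq_bigr => i _; rewrite mcoeffZ mxE enum_rankK -mE.
Qed.

(* A solution of the relations with [y = 0] showing that [Z_(2n)] is not in the
   ideal generated by the previous [Z_i]. *)
Definition zfrac (F : fieldType) (a : F) i : {poly F} :=
  if odd i then 0 else (a ^- i./2)%:P * 'X.

Lemma zfrac_rel (F : fieldType) (a : F) : a != 0 -> B_rel a%:P 0 (zfrac a).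
Proof.
move=> a0; case=> // i _; have := s_ge2 (isT : (0 < i.+2)%N).
case: (s i.+2) => [|[|n]] // _.
have oddSS : odd i.+2 = odd i by rewrite /= negbK.
rewrite [0 ^+ _]exprS !mul0r addr0 /zfrac oddSS; case: ifP => _; first by rewrite mulr0 subr0.
by rewrite mulrA -polyCM exprS invfM mulVKf ?subrr.
Qed.

Section Conclusions.
Variables (k : fieldType) (B : comNzRingType) (iota : {rmorphism k -> B}).
Variables (x y : B) (Z : nat -> B).
Hypothesis HB : presents_B iota x y Z.

Let dom := B_integral HB.
Let x0 : x != 0 := (prime_x HB).1.

(** The retraction [r] makes the [v i] algebraically independent in [P4 k], and [evn_inj] carries
    this over to [B]. *)
Lemma mmap_retract_inj n (v : 'I_n -> P4 k) (r : {rmorphism P4 k -> {mpoly k[n]}}) :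
  (forall c, r (vC k c) = c%:MP) -> (forall i, r (v i) = 'X_i) ->
  injective (mmap iota (evn iota x y Z 0 \o v)).
Proof.
move=> rC rv p q.
have E p' : mmap iota (evn iota x y Z 0 \o v) p' = evn iota x y Z 0 (mmap (vC k) v p').
  by rewrite rmorph_mmap; apply: eq_mmap => c //=; rewrite evnE.
rewrite !E => /(evn_inj HB) /(congr1 r); rewrite !rmorph_mmap.
by rewrite !(eq_mmap (g := @mpolyC n k) (w := fun i => 'X_i)) // !mmap_id.
Qed.

Lemma A_to_B_inj : injective (A_to_B iota x y).
Proof.
pose v (i : 'I_2) := if val i == 0%N then vX k else vY k.
pose r : {rmorphism P4 k -> {mpoly k[2]}} :=
  ev4 (@mpolyC 2 k) 'X_(inord 1) 0 'X_(inord 0) 0.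
have E p : A_to_B iota x y p = mmap iota (evn iota x y Z 0 \o v) p.
  apply: eq_mmap => // i; rewrite /v [RHS]/=.
    by case: (val i == 0%N); rewrite evnE.
move=> p q; rewrite !E; apply: (mmap_retract_inj (r := r)) => [c|i].
  by rewrite /r ev4C.
by case: i => [[|[|i]] il] //; rewrite /v /r ?ev4X ?ev4Y; congr 'X_ _;
  apply: val_inj; rewrite /= inordK.
Qed.

Definition var4 (i : 'I_4) : P4 k := nth 0 [:: vX k; vY k; vU k; vT k] i.

Definition to_mpoly4 : {rmorphism P4 k -> {mpoly k[4]}} :=
  ev4 (@mpolyC 4 k) 'X_(inord 1) 'X_(inord 2) 'X_(inord 0) 'X_(inord 3).

Lemma to_mpoly4_var i : to_mpoly4 (var4 i) = 'X_i.
Proof.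
by case: i => [[|[|[|[|i]]]] il] //; rewrite /var4 /to_mpoly4 /= ?ev4X ?ev4Y ?ev4U ?ev4T;
  congr 'X_ _; apply: val_inj; rewrite /= inordK.
Qed.

Lemma of_mpoly4K p : mmap (vC k) var4 (to_mpoly4 p) = p.
Proof.
rewrite -[RHS]ev4_id /to_mpoly4 (rmorph_ev4 _ (mmap (vC k) var4)) /=.
rewrite !mmapX !mmap1U /var4 !inordK //=.
by apply: eq_ev4 => c /=; rewrite mmapC.
Qed.

(** Five elements of [B] lift to a common level, a polynomial ring in four variables, where they are
    dependent. *)
Lemma trdeg_B : trdeg_eq iota 4.
Proof.
split.
  exists (evn iota x y Z 0 \o var4) => p p0.
  apply: (mmap_retract_inj (r := to_mpoly4) _ to_mpoly4_var).
    by move=> c; rewrite /to_mpoly4 ev4C.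
  by rewrite p0 rmorph0.
move=> v vind; have [m0 h] := evn_surj_seq HB (codom v).
have /fin_all_exists [p pE] i : exists p, evn iota x y Z m0 p = v i.
  by apply: (h m0) => //; apply: codom_f.
have [Q Q0 QE] := mpoly_alg_dependent (to_mpoly4 \o p).
case/eqP: Q0; apply: vind.
have := congr1 (mmap iota (evn iota x y Z m0 \o var4)) QE.
rewrite rmorph0 rmorph_mmap => <-; apply: eq_mmap => [c|i] /=; first by rewrite mmapC.
rewrite -pE -[in LHS](of_mpoly4K (p i)) rmorph_mmap.
by apply: eq_mmap => // c /=; rewrite evnE.
Qed.

(** * Failure of the noetherian property *)

Section Noetherian.
Local Notation K := {fraction {poly k}}.
Local Notation tofrac := (@FracField.tofrac {poly k}).

Let X : K := tofrac 'X.

Lemma X_neq0 : X != 0.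
Proof. by rewrite tofrac_eq0 polyX_eq0. Qed.

Lemma not_noetherian_B : ~ noetherian B.
Proof.
pose f : {rmorphism k -> {poly K}} := polyC \o (tofrac \o polyC).
have [g [gi gx gy gZ _]] := HB.2 _ f _ _ _ (zfrac_rel X_neq0).
have g0 b : exists p, (g b)`_0 = tofrac p.
  elim/(gen_ind HB): b => [c|||i|a b [p pE] [q qE]|a b [p pE] [q qE]].
  - by exists c%:P; rewrite gi /f /= coefC.
  - by exists 'X; rewrite gx coefC.
  - by exists 0; rewrite gy coef0 rmorph0.
  - by exists 0; rewrite gZ rmorph0 /zfrac; case: ifP; rewrite ?coef0 // coefMX.
  - by exists (p - q); rewrite !rmorphB coefB pE qE.
  - by exists (p * q); rewrite !rmorphM coef0M pE qE.
(* The linear coefficient may have the denominator [X ^+ n]. This gives an ideal because, by [g0],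
   constant terms have no denominator; [Z (N.+1).*2], of linear coefficient [X ^- N.+1], is in
   [I N.+1] but not in [I N]. *)
pose I n b := (g b)`_0 = 0 /\ exists p, X ^+ n * (g b)`_1 = tofrac p.
move=> /(_ I) [n||N IN].
- split.
  + by rewrite /I rmorph0 !coef0; split=> //; exists 0; rewrite mulr0 rmorph0.
  + move=> a b [a0 [p pE]] [b0 [q qE]]; split; first by rewrite rmorphD coefD a0 b0 addr0.
    by exists (p + q); rewrite !rmorphD coefD mulrDr pE qE.
  + move=> r a [a0 [p pE]]; split; first by rewrite rmorphM coef0M a0 mulr0.
    have [q qE] := g0 r; exists (q * p).
    rewrite !rmorphM coefM big_ord_recr big_ord_recr big_ord0 /= a0 mulr0 addr0 add0r.
    by rewrite mulrCA pE qE.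
- move=> n a [a0 [p pE]]; split=> //; exists ('X * p).
  by rewrite exprS -mulrA pE rmorphM.
have gZ2 : (g (Z (N.+1).*2))`_1 = X ^- N.+1.
  by rewrite gZ /zfrac odd_double doubleK coefMX coefC.
have [|_ [p]] := IN N.+1 (leqnSn N) (Z (N.+1).*2).
  split; first by rewrite gZ /zfrac odd_double coefMX.
  by exists 1; rewrite gZ2 rmorph1 divff // expf_neq0 // X_neq0.
rewrite gZ2 exprSr invfM mulrA divff ?expf_neq0 ?X_neq0 // mul1r => E.
have : tofrac 1 = tofrac ('X * p) by rewrite rmorphM /= -E rmorph1 divff // X_neq0.
move/eqP; rewrite tofrac_eq => /eqP /(congr1 (fun q : {poly k} => q`_0)).
by rewrite coefXM coef1 => /eqP; rewrite oner_eq0.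
Qed.
End Noetherian.

(** * The residue map to k and the maximal ideal (x, y) *)

Lemma augmentation : exists e : {rmorphism B -> k},
  [/\ forall c, e (iota c) = c, e x = 0, e y = 0 & forall i, e (Z i) = 0].
Proof.
have rel0 : B_rel (0 : k) 0 (fun=> 0).
  move=> i i0; have := s_ge2 (isT : (0 < i.+1)%N); case: (s i.+1) => // n _.
  by rewrite exprS !mul0r mulr0 !addr0 subr0.
by have [e [ei ex ey eZ _]] := HB.2 _ idfun _ _ _ rel0; exists e.
Qed.

Lemma augmentation_kernel (e : {rmorphism B -> k}) b :
  (forall c, e (iota c) = c) -> e x = 0 -> e y = 0 -> (forall i, e (Z i) = 0) ->
  exists u v, b - iota (e b) = x * u + y * v.
Proof.
move=> ei ex ey eZ; elim/(gen_ind HB): b =>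
  [c|||i|a b [u [v E]] [u' [v' E']]|a b [u [v E]] [u' [v' E']]].
- by exists 0, 0; rewrite ei subrr !mulr0 addr0.
- by exists 1, 0; rewrite ex rmorph0 subr0 mulr1 mulr0 addr0.
- by exists 0, 1; rewrite ey rmorph0 subr0 mulr1 mulr0 add0r.
(* The relation writes [Z i] in terms of [x] and [y], since [s i.+2 >= 2] leaves at least one factor
   [y]. *)
- exists (Z i.+2), (y ^+ (s i.+2).-2 * Z i.+1 ^+ s i.+2); rewrite eZ rmorph0 subr0.
  have /eqP := HB.1 i.+1 isT; rewrite subr_eq0 => /eqP /= <-; congr (_ + _).
  by rewrite mulrA -exprS; have := s_ge2 (isT : (0 < i.+2)%N); case: (s i.+2) => [|[]].
- exists (u - u'), (v - v'); rewrite !rmorphB.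
  have -> : a - b - (iota (e a) - iota (e b)) = a - iota (e a) - (b - iota (e b)) by ring.
  by rewrite E E'; ring.
exists (a * u' + u * iota (e b)), (a * v' + v * iota (e b)); rewrite !rmorphM.
have -> : a * b - iota (e a) * iota (e b) =
  a * (b - iota (e b)) + (a - iota (e a)) * iota (e b) by ring.
by rewrite E E'; ring.
Qed.

Lemma maximal_xy : maximal_ideal (fun c : B => exists u v : B, c = x * u + y * v).
Proof.
have [e [ei ex ey eZ]] := augmentation.
have ker b : e b = 0 -> exists u v : B, b = x * u + y * v.
  by move=> eb; have := augmentation_kernel b ei ex ey eZ; rewrite eb rmorph0 subr0.
split.
- split; first by exists 0, 0; rewrite !mulr0 addr0.
    by move=> a b [u [v ->]] [u' [v' ->]]; exists (u + u'), (v + v'); ring.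
  by move=> r a [u [v ->]]; exists (r * u), (r * v); ring.
- case=> u [v /(congr1 e)]; rewrite rmorph1 rmorphD !rmorphM ex ey !mul0r addr0 => /eqP.
  by rewrite oner_eq0.
move=> J [J0 JD JM] IJ; case: (classic (forall a, J a -> exists u v : B, a = x * u + y * v)).
  by left.
case/not_all_ex_not => a naJ; have [Ja na] := imply_to_and _ _ naJ.
right; have ea : e a != 0 by apply/eqP => /ker.
have Jea : J (iota (e a)).
  have -> : iota (e a) = a + -1 * (a - iota (e a)) by ring.
  by apply: JD => //; apply: JM; apply: IJ; apply: augmentation_kernel.
have -> : 1 = iota (e a)^-1 * iota (e a) by rewrite -rmorphM mulVf // rmorph1.
exact: JM.
Qed.
End Conclusions.

(** * The ring B[T]/(xT - y) *)

Section LinearQuotient.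
Variables (B : comNzRingType) (x y : B).
Hypothesis dom : integral_domain B.
Hypothesis x0 : x != 0.
Hypothesis xy : forall b, dvdr x (y * b) -> dvdr x b.
Local Notation lin := (x%:P * 'X - y%:P).

Lemma coef_mul_lin (q : {poly B}) i : (q * lin)`_i.+1 = x * q`_i - y * q`_i.+1.
Proof. by rewrite mulrBr mulrCA coefB coefCM coefMX [q * _]mulrC coefCM. Qed.

(** A nonzero [q] would give the product the nonzero coefficient [x * lead_coef q] in positive
    degree. Thus [B] embeds in the quotient. *)
Lemma const_mul_lin c (q : {poly B}) : c%:P = q * lin -> c = 0.
Proof.
move=> E; suff q0 : q = 0 by apply/eqP; rewrite -polyC_eq0 E q0 mul0r.
apply/eqP; apply/negPn/negP => q0.
have := congr1 (fun p : {poly B} => p`_(size q).-1.+1) E.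
rewrite coefC [LHS]/= coef_mul_lin prednK ?size_poly_gt0 // [q`_(size q)]nth_default //.
rewrite mulr0 subr0 => xq.
case: (dom.2 _ _ (esym xq)) => /eqP; first by apply/negP.
by rewrite -/(lead_coef q) lead_coef_eq0 (negbTE q0).
Qed.

(** Each factor [x] turns one ['X] into [y] modulo [lin]. *)
Lemma reduce_mod_lin (f : {poly B}) : exists N c q, (x ^+ N)%:P * f = c%:P + q * lin.
Proof.
elim/poly_ind: f => [|f a [N [c [q E]]]].
  by exists 0%N, 0, 0; rewrite mulr0 mul0r addr0.
exists N.+1, (c * y + x ^+ N.+1 * a), (c%:P + q * (x%:P * 'X)).
have -> : (x ^+ N.+1)%:P * (f * 'X + a%:P) =
  ((x ^+ N)%:P * f) * (x%:P * 'X) + (x ^+ N.+1 * a)%:P.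
  by rewrite exprS !polyCM; ring.
by rewrite E !polyCM polyCD !polyCM; ring.
Qed.

(** Read modulo [x], the equation says that [x] divides every [y * q]_i[, hence every]q[_i] by [xy];
    one factor [x] can then be cancelled. *)
Lemma cancel_x_mod_lin N (f q : {poly B}) : (x ^+ N)%:P * f = q * lin ->
  exists q', f = q' * lin.
Proof.
elim: N f q => [|N IH] f q; first by rewrite expr0 mul1r => ->; exists q.
rewrite exprS polyCM -mulrA => E.
have xq i : dvdr x q`_i.
  apply: xy; case: i => [|i].
    have := congr1 (fun p : {poly B} => p`_0) E; rewrite coefCM mulrBr coefB => E0.
    exists (- ((x ^+ N)%:P * f)`_0); rewrite mulrN E0 mulrA coefMX /= sub0r opprK.
    by rewrite [q * _]mulrC coefCM.
  have := congr1 (fun p : {poly B} => p`_i.+1) E; rewrite coefCM coef_mul_lin => E0.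
  exists (q`_i - ((x ^+ N)%:P * f)`_i.+1); rewrite mulrBr E0; ring.
have [q' qE] := dvdr_polyC_coef xq.
apply: (IH f q'); apply/polyP => i; apply: (domI dom x0).
by rewrite -!coefCM E qE mulrA.
Qed.

Variables (B' : comPzRingType) (pi : {rmorphism {poly B} -> B'}).
Hypothesis pi_surj : forall b', exists p, pi p = b'.
Hypothesis pi_ker : forall p, pi p = 0 <-> exists q, p = q * lin.

(** Up to powers of [x], [f] and [g] are congruent to constants [c] and [d]. Their product is a
    multiple of [lin], hence zero, and [cancel_x_mod_lin] turns [c = 0] or [d = 0] into the
    vanishing of a factor. *)
Lemma lin_quotient_integral : integral_domain B'.
Proof.
split.
  apply/eqP => one0; have : pi 1%:P = 0 by rewrite rmorph1.
  case/pi_ker => q /const_mul_lin /eqP; apply/negP; exact: oner_neq0.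
move=> a b; have [f <-] := pi_surj a; have [g <-] := pi_surj b.
rewrite -rmorphM => /pi_ker [q E].
have [N [c [q1 E1]]] := reduce_mod_lin f.
have [M [d [q2 E2]]] := reduce_mod_lin g.
have cd : c * d = 0.
  apply: (@const_mul_lin _ ((x ^+ N)%:P * (x ^+ M)%:P * q
    - c%:P * q2 - q1 * d%:P - q1 * q2 * lin)).
  have -> : (c * d)%:P = (c%:P + q1 * lin) * (d%:P + q2 * lin)
    - (c%:P * q2 + q1 * d%:P + q1 * q2 * lin) * lin by rewrite polyCM; ring.
  rewrite -E1 -E2.
  have -> : (x ^+ N)%:P * f * ((x ^+ M)%:P * g) = (x ^+ N)%:P * (x ^+ M)%:P * (f * g) by ring.
  by rewrite E; ring.
have zero p N' c' q' : (x ^+ N')%:P * p = c'%:P + q' * lin -> c' = 0 -> pi p = 0.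
  by move=> E' c0; apply/pi_ker; apply: (@cancel_x_mod_lin N' p q'); rewrite E' c0 add0r.
by case: (dom.2 _ _ cd) => [/(zero _ _ _ _ E1)|/(zero _ _ _ _ E2)]; [left|right].
Qed.

Lemma pi_const_eq0 c : pi c%:P = 0 -> c = 0.
Proof. by case/pi_ker => q /const_mul_lin. Qed.

Lemma pi_xT : pi x%:P * pi 'X = pi y%:P.
Proof.
apply/eqP; rewrite -rmorphM -subr_eq0 -rmorphB; apply/eqP/pi_ker.
by exists 1; rewrite mul1r.
Qed.

(** The quotients [c n] of [b] by [X ^+ n] generate a strictly increasing chain: each is [X] times
    the next, and [X] is not a unit. *)
Lemma lin_quotient_not_ACCP (b : B) : b != 0 ->
  (forall n, dvdr (pi x%:P ^+ n) (pi b%:P)) -> ~ unitr (pi x%:P) -> ~ ACCP B'.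
Proof.
move=> b0 bdiv nx accp; have [one0 idom] := lin_quotient_integral.
set X := pi x%:P in bdiv nx.
have X0 : X != 0 by apply: contra_neq x0 => /pi_const_eq0.
have cancel (a c d : B') : a != 0 -> a * c = a * d -> c = d.
  move=> a0 /eqP; rewrite -subr_eq0 -mulrBr => /eqP /idom [/eqP|/eqP].
    by rewrite (negbTE a0).
  by rewrite subr_eq0 => /eqP.
have Xn0 n : X ^+ n != 0.
  elim: n => [|n IH]; first by rewrite expr0.
  by rewrite exprS; apply/eqP => /idom [] /eqP; apply/negP.
pose c n := proj1_sig (constructive_indefinite_description _ (bdiv n)).
have cE n : pi b%:P = X ^+ n * c n by rewrite /c; case: constructive_indefinite_description.
have cS n : c n = c n.+1 * X.
  by apply: (cancel _ _ _ (Xn0 n)); rewrite -cE (cE n.+1) exprSr -mulrA [c _ * X]mulrC.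
have [|N hN] := accp c; first by move=> n; exists X.
have [d E] := hN N.+1 (leqnSn N).
apply: nx; exists d; apply: (cancel (c N.+1)).
  by apply: contra_neq b0 => c0; apply: pi_const_eq0; rewrite (cE N.+1) c0 mulr0.
by rewrite mulr1 mulrA -cS.
Qed.
End LinearQuotient.

Theorem theorem6p1 (k : fieldType) (chk0 : [pchar k] =i pred0)
    (B : comNzRingType) (iota : {rmorphism k -> B}) (x y : B) (Z : nat -> B)
    (HB : presents_B iota x y Z) :
  (* (a) *)
  (UFD B /\ ~ noetherian B /\ trdeg_eq iota 4 /\
   injective (A_to_B iota x y) /\
   (prime_elt x /\ prime_elt y /\ ~ associated x y) /\
   maximal_ideal (fun c : B => exists u v : B, c = x * u + y * v))
  /\
  (* (b) B' = B[T]/(xT - y), given as a surjection from B[T] with that kernel *)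
  (forall (B' : comPzRingType) (pi : {rmorphism {poly B} -> B'}),
      (forall b' : B', exists p, pi p = b') ->
      (forall p : {poly B}, pi p = 0 <-> exists q, p = q * (x%:P * 'X - y%:P)) ->
      integral_domain B' /\ ~ ACCP B').
Proof.
have dom := B_integral HB.
have px := prime_x HB; have [x0 [_ xdiv]] := px.
have nxy := not_dvdr_x_y HB.
split.
  split; first exact: factorial_UFD (factorial_B HB).
  split; first exact: not_noetherian_B HB.
  split; first exact: trdeg_B HB.
  split; first exact: A_to_B_inj HB.
  split; last exact: maximal_xy HB.
  by split; [|split; [exact: prime_y HB|case]].
move=> B' pi pi_surj pi_ker.
have xy b : dvdr x (y * b) -> dvdr x b by case/xdiv.
split; first exact (lin_quotient_integral dom x0 xy pi_surj pi_ker).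
have Z0 : Z 0 != 0.
  rewrite -(evn_vU iota x y Z 0) -(rmorph0 (evn iota x y Z 0)).
  apply/eqP => /(evn_inj HB) /(congr1 (@to_mpoly4 k)).
  rewrite /to_mpoly4 ev4U rmorph0 => /(congr1 (mcoeff U_(inord 2))) /eqP.
  by rewrite mcoeffXU eqxx mcoeff0 oner_eq0.
apply: (lin_quotient_not_ACCP dom x0 xy pi_surj pi_ker Z0).
  suff Zdiv n i : dvdr (pi x%:P ^+ n) (pi (Z i)%:P) by move=> n; apply: Zdiv.
  (* In [Z i = x Z_(i+2) + y^(s(i+2)-1) Z_(i+1)^(s(i+2))] both terms gain a factor [x], as [y = xT]
     in [B']. *)
  elim: n i => [|n IH] i; first by exists (pi (Z i)%:P); rewrite expr0 mul1r.
  have [c cE] := IH i.+2; have [d dE] := IH i.+1.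
  have [m [m' [E E']]] : exists m m', (s i.+2).-1 = m.+1 /\ s i.+2 = m'.+1.
    by have := s_ge2 (isT : (0 < i.+2)%N); case: (s i.+2) => [|[|j]] // _; exists j, j.+1.
  have /eqP := HB.1 i.+1 isT; rewrite subr_eq0 E E' => /eqP /= <-.
  exists (c + pi 'X * pi (y ^+ m)%:P * d * pi (Z i.+1 ^+ m')%:P).
  rewrite polyCD [y ^+ m.+1]exprS [Z i.+1 ^+ m'.+1]exprS !polyCM rmorphD !rmorphM.
  rewrite cE dE -(pi_xT pi_ker).
  by rewrite exprS; ring.
(* If [x] were a unit, [x p - 1] would be a multiple of [xT - y]; the augmentation of the constant
   terms would give [-1 = 0]. *)
case=> u; have [p <-] := pi_surj u; rewrite -rmorphM => /eqP.
rewrite -subr_eq0 -[1](rmorph1 pi) -rmorphB => /eqP /pi_ker [q E].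
have [e [ei ex ey eZ]] := augmentation HB.
have := congr1 (fun p : {poly B} => e p`_0) E.
rewrite coefB coefCM coef1 coef0M coefB coefCM coefX coefC /= mulr0 sub0r.
rewrite rmorphB !rmorphM rmorphN ex ey oppr0 mulr0 mul0r rmorph1 sub0r => /eqP.
by rewrite oppr_eq0 oner_eq0.
Qed.
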